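(* Let $\mu$ be a positive Borel measure on $\mathbb{R}^n$ such that $$\int_{\mathbb{R}^n} w(x)^{-1}\,d\mu(x)<\infty$$ for some (Borel) measurable quasi-analytic weight $w$ on $\mathbb{R}^n$. Then $\mu$ is determinate. Furthermore, the polynomials, and also $\operatorname{Span}_{\mathbb{C}}\{e_{i\lambda}\mid\lambda\in S\}$ for every subset $S$ of $\mathbb{R}^n$ which is somewhere dense, are then dense in $L_p(\mathbb{R}^n,\mu)$ for all $1\leq p<\infty$.
   Context: $(\cdot,\cdot)$ is the standard inner product on $\mathbb{R}^n$ with norm $\Vert\cdot\Vert$. For $\lambda\in\mathbb{R}^n$, $e_{i\lambda}:\mathbb{R}^n\to\mathbb{C}$ is $e_{i\lambda}(x)=\exp(i(\lambda,x))$. A subset $S\subset\mathbb{R}^n$ is somewhere dense if its closure has non-empty interior. $\mathcal{M}^*$ is the set of all positive Borel measures $\mu$ on $\mathbb{R}^n$ such that $\int_{\mathbb{R}^n}\Vert x\Vert^d\,d\mu(x)<\infty$ for all $d\ge 0$. A measure $\mu$ is determinate if $\mu\in\mathcal{M}^*$ and $\mu$ is uniquely determined in $\mathcal{M}^*$ by the integrals $\int_{\mathbb{R}^n}P\,d\mu$ of all polynomials $P$ on $\mathbb{R}^n$ (i.e. any $\nu\in\mathcal{M}^*$ with the same integrals of all polynomials equals $\mu$). $L_p$-spaces consist of complex-valued functions and polynomials have complex coefficients. A weight on $\mathbb{R}^n$ is an arbitrary bounded function $w:\mathbb{R}^n\to\mathbb{R}_{\ge 0}$ (no regularity assumed). Given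 a basis $\{v_1,\ldots,v_n\}$ of $\mathbb{R}^n$, the weight $w$ is quasi-analytic with respect to $\{v_1,\ldots,v_n\}$ if $$\sum_{m=1}^\infty \frac{1}{\Vert (v_j,x)^m w(x)\Vert_\infty^{1/m}}=\infty\qquad (j=1,\ldots,n),$$ where $\Vert\cdot\Vert_\infty$ is the supremum over all $x\in\mathbb{R}^n$ (with $1/0=+\infty$ and $1/\infty=0$). A weight is quasi-analytic if it is quasi-analytic with respect to some basis of $\mathbb{R}^n$. In $w^{-1}$, $1/0$ is read as $+\infty$. *)

(* Defs.v *)
From HB Require Import structures.
From mathcomp Require Import all_boot all_order all_algebra.
From mathcomp Require Import complex.
From mathcomp Require Import all_classical all_reals all_analysis.
From mathcomp Require mpoly.
Import Order.TTheory GRing.Theory Num.Theory.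
Import numFieldNormedType.Exports.

Set Implicit Arguments.
Unset Strict Implicit.
Unset Printing Implicit Defensive.

Local Open Scope classical_set_scope.
Local Open Scope ring_scope.

(* The canonical norm of 'rV[R]_n is the sup norm, hence the explicit inner
   product and Euclidean norm; the topology is the usual one. *)
Definition dot (R : realType) (n : nat) (x y : 'rV[R]_n) : R :=
  \sum_(i < n) x ord0 i * y ord0 i.

Definition enorm (R : realType) (n : nat) (x : 'rV[R]_n) : R :=
  Num.sqrt (dot x x).

(* R^n with its Borel sigma-algebra, the one generated by the open sets. *)
Notation borelRn R n := (g_sigma_algebraType (@open 'rV[R]_n)).

Definition somewhere_dense (T : topologicalType) (S : set T) : Prop :=
  (closure S)° !=set0.

Definition is_weight (R : realType) (n : nat) (w : 'rV[R]_n -> R) : Prop :=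
  (forall x, 0 <= w x) /\ bounded_fun w.

(* In \bar R: 0^-1 = +oo, +oo^-1 = 0, and +oo `^ r = +oo for r > 0. *)
Definition quasi_analytic_wrt (R : realType) (n : nat)
    (v : n.-tuple 'rV[R]_n) (w : 'rV[R]_n -> R) : Prop :=
  forall j : 'I_n,
    (\sum_(1 <= m <oo)
       (ereal_sup [set `|(dot (tnth v j) x ^+ m * w x)%:E| | x in setT]
          `^ (m%:R^-1))^-1 = +oo)%E.

Definition quasi_analytic (R : realType) (n : nat) (w : 'rV[R]_n -> R) : Prop :=
  exists v : n.-tuple 'rV[R]_n,
    basis_of fullv v /\ quasi_analytic_wrt v w.

Definition mpoly_fun (R : realType) (n : nat) (P : mpoly.mpoly n R[i])
    (x : 'rV[R]_n) : R[i] :=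
  mpoly.meval (fun i => (x ord0 i)%:C%C) P.

Definition polynomials (R : realType) (n : nat) : set ('rV[R]_n -> R[i]) :=
  range (@mpoly_fun R n).

Definition expi (R : realType) (n : nat) (l x : 'rV[R]_n) : R[i] :=
  (cos (dot l x) +i* sin (dot l x))%C.

Definition cspan (R : realType) (T : Type) (A : set (T -> R[i])) :
    set (T -> R[i]) :=
  [set f | exists (k : nat) (c : 'I_k -> R[i]) (g : 'I_k -> T -> R[i]),
     (forall j, A (g j)) /\ f = (fun x => \sum_(j < k) c j * g j x)].

Definition exponentials (R : realType) (n : nat) (S : set 'rV[R]_n) :
    set ('rV[R]_n -> R[i]) :=
  [set expi l | l in S].

(* Meaningful for integrable f only, since Rintegral is the fine part of the
   extended-real integral. *)
Definition cintegral (d : measure_display) (T : measurableType d)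
    (R : realType) (mu : {measure set T -> \bar R}) (f : T -> R[i]) : R[i] :=
  (Rintegral mu setT (fun x => complex.Re (f x)) +i*
   Rintegral mu setT (fun x => complex.Im (f x)))%C.

Definition finite_moments (R : realType) (n : nat)
    (mu : {measure set (borelRn R n) -> \bar R}) : Prop :=
  forall d : R, 0 <= d ->
    (\int[mu]_x ((enorm (x : 'rV[R]_n)) `^ d)%:E < +oo)%E.

(* Library measures are functions of all sets, so they are compared on Borel
   sets only. *)
Definition determinate (R : realType) (n : nat)
    (mu : {measure set (borelRn R n) -> \bar R}) : Prop :=
  finite_moments mu /\
  forall nu : {measure set (borelRn R n) -> \bar R},
    finite_moments nu ->
    (forall P : mpoly.mpoly n R[i],
       cintegral nu (mpoly_fun P) = cintegral mu (mpoly_fun P)) ->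
    forall A : set (borelRn R n), measurable A -> nu A = mu A.

Definition cLnorm (d : measure_display) (T : measurableType d)
    (R : realType) (mu : {measure set T -> \bar R}) (p : R) (f : T -> R[i]) :
    \bar R :=
  Lnorm mu p%:E (fun x => (ComplexField.Normc.normc (f x))%:E).

(* Functions are not quotiented by almost everywhere equality; density below is
   with respect to the seminorm. *)
Definition cLfun (d : measure_display) (T : measurableType d)
    (R : realType) (mu : {measure set T -> \bar R}) (p : R) :
    set (T -> R[i]) :=
  [set f | [/\ measurable_fun setT (fun x => complex.Re (f x)),
               measurable_fun setT (fun x => complex.Im (f x)) &
               (cLnorm mu p f < +oo)%E]].

Definition dense_in_Lp (d : measure_display) (T : measurableType d)
    (R : realType) (mu : {measure set T -> \bar R}) (p : R)
    (A : set (T -> R[i])) : Prop :=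
  A `<=` cLfun mu p /\
  forall f, cLfun mu p f -> forall e : R, 0 < e ->
    exists2 g, A g & (cLnorm mu p (fun x => f x - g x)%R < e%:E)%E.

(* Main.v *)
(* Neither duality nor Fourier transforms are needed: everything reduces to
   approximating P e_{i l} by polynomials in L_p(rho), for rho = mu and for
   rho = mu + nu with nu another solution of the moment problem.  Along a line
   t |-> e_{i(l + t v)}, the distances of y^j P e_{i(l + t v)} to the polynomials,
   where y = (v, .), satisfy the Taylor inequalities of the derivatives of a
   smooth function, with bounds proportional to M_j = U_{Qj}^{1/Q}, where
   U_m = sup_x max(1, |y|^m w / C), and they vanish at t = 0 if P e_{i l} is a limit
   of polynomials for every P.  By Bang's proof of the Denjoy-Carleman theorem
   they vanish for all t, and every l is reached along the given basis.
   The bounded functions u such that u P is a limit of polynomials for every P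
   then form an algebra closed under bounded pointwise limits and containing
   cos (l, x) and sin (l, x), hence the signs of x_i - a, hence the indicators of
   Borel sets; so polynomials are dense.  If S is dense near l, difference
   quotients of exponentials approximate P e_{i l}, and multiplication by e_{i l} is
   an isometry.  Finally, polynomials are dense in L_1(mu + nu) and have the same
   integrals for mu and nu, so mu = nu. *)
Require Import Defs.
From HB Require Import structures.
From mathcomp Require Import all_boot all_order all_algebra.
From mathcomp Require Import complex.
From mathcomp Require Import all_classical all_reals all_analysis.
From mathcomp Require Import measurable_realfun ring lra.
From mathcomp Require mpoly.
Import (canonicals) mpoly.
Import Order.TTheory GRing.Theory Num.Theory.
Import numFieldNormedType.Exports.

Set Implicit Arguments.
Unset Strict Implicit.
Unset Printing Implicit Defensive.

Local Open Scope classical_set_scope.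
Local Open Scope ring_scope.

Local Notation normc := (@ComplexField.Normc.normc _).

(** * Bang's argument *)

(** The distances to the polynomials are not known to be smooth along the line, so Bang's argument
    is run on a relation [A j t d], read as: the [j]-th distance at time [t] is at most [d]. The
    weight controls the roots [U_m^(1/m)], whereas Bang's argument consumes the ratios
    [M_k / M_(k+1)]. Carleman's inequality connects the two: the first [m] ratios have product
    [1 / M_m], whose [m]-th root is the inverse of [U_(Qm)^(1/(Qm))]. Keeping only every [Q]-th term
    of the series preserves divergence because the roots are nondecreasing, which holds because
    division by [C] makes the weight at most 1. The maximum with 1 keeps the roots at least 1. The
    value [Q = 2 r], with an integer [r >= p], comes from the L_p norm: [|P y^j|^p] is split into a
    part depending on [P] alone and a multiple of [y^(2rj)], whose integral is the integral of a
    nonnegative polynomial and hence the same for every solution of the moment problem. *)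

Lemma half_geometric_sum (R : realType) (m : nat) :
  \sum_(i < m) (2^-1 : R) ^+ i <= 2.
Proof.
suff -> : \sum_(i < m) (2^-1 : R) ^+ i = 2 - 2 * 2^-1 ^+ m.
  by rewrite gerBl mulr_ge0// exprn_ge0// invr_ge0.
elim: m => [|m IH]; first by rewrite big_ord0 expr0 mulr1 subrr.
by rewrite big_ord_recr/= IH exprS; field.
Qed.

Section Bang.
(** The model for [A j t d] is a bound [d] on the [j]-th derivative at time [t], with [M j] bounding
    that derivative everywhere. Taylor's formula is assumed without its factors [1/i!]; the argument
    can afford the loss. *)
Context (R : realType) (M : nat -> R) (A : nat -> R -> R -> Prop).
Hypothesis M_gt0 : forall k, 0 < M k.
Hypothesis M_logconvex : forall k, M k.+1 ^+ 2 <= M k * M k.+2.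
Hypothesis M_div :
  forall B, exists N : nat, B <= \sum_(k < N) M k / M k.+1.
Hypothesis A_mono : forall j t d d', d <= d' -> A j t d -> A j t d'.
Hypothesis A_init : forall j d, 0 < d -> A j 0 d.
Hypothesis A_taylor : forall j m t h (d : nat -> R), 0 <= t -> 0 <= h ->
  (forall i, (i < m)%N -> A (j + i)%N t (d i)) ->
  A j (t + h) (\sum_(i < m) h ^+ i * d i + h ^+ m * M (j + m)%N).

Let b k := M k / M k.+1.

Let b_gt0 k : 0 < b k. Proof. exact: divr_gt0. Qed.

Let b_anti k l : (k <= l)%N -> b l <= b k.
Proof.
move=> /subnK <-; elim: (l - k)%N => [//|i IH]; rewrite addSn.
apply: le_trans IH; rewrite /b ler_pdivrMr// mulrAC ler_pdivlMr//.
by rewrite -expr2.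
Qed.

(** [M (j + i)] is [M j] divided by the [i] successive ratios [b j, ..., b (j + i - 1)], none of
    which is smaller than [b N]. *)
Let M_geometric N j i : (j + i <= N.+1)%N -> b N ^+ i * M (j + i)%N <= M j.
Proof.
elim: i => [|i IH]; first by rewrite expr0 mul1r addn0.
rewrite addnS => jiN; apply: le_trans (IH (ltnW jiN)).
rewrite exprSr -mulrA ler_wpM2l ?exprn_ge0 ?(ltW (b_gt0 _))//.
have /b_anti : (j + i <= N)%N by [].
by rewrite {2}/b ler_pdivlMr.
Qed.

(** In the model this says that Bang's quantity, the supremum over [j] of [|f^(j)(t)| / (2^j M_j)],
    is at most [2^-N]. Orders [j] above [N] carry no clause, since there [2^j / 2^N >= 1] and the a
    priori bound [M_j] suffices. *)
Let below N t := forall j, (j <= N)%N -> A j t (2 ^+ j / 2 ^+ N * M j).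

(** In [h <= b N / 4], one factor 2 offsets the growth of the weights [2^(j+i)] and the other gives
    the Taylor terms ratio [1/2]. Their sum is then at most twice the leading term, and this 2 is
    the one level lost. *)
Let below_step N t h : 0 <= t -> 0 <= h -> h <= b N / 4 ->
  below N.+1 t -> below N (t + h).
Proof.
move=> t0 h0 hb At j jN.
set d := fun i : nat => 2 ^+ (j + i) / 2 ^+ N.+1 * M (j + i)%N : R.
have := @A_taylor j (N.+1 - j)%N t h d t0 h0.
have -> : (j + (N.+1 - j) = N.+1)%N by rewrite subnKC// leqW.
move=> H; apply: A_mono (H _); last first.
  by move=> i; rewrite ltn_subRL => ji; apply: At; rewrite ltnW.
(* Expanding to order [N + 1 - j] makes the remainder have the form of one more Taylor term, so it
   joins the geometric sum. *)
have -> : M N.+1 = d (N.+1 - j)%N.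
  by rewrite /d subnKC ?leqW// divff ?mul1r// expf_neq0.
rewrite -(big_ord_recr _ (fun i => h ^+ i * d i))/=.
have -> : 2 ^+ j / 2 ^+ N * M j = 2 ^+ j / 2 ^+ N.+1 * M j * 2 :> R.
  by rewrite [2 ^+ N.+1]exprS; field; rewrite expf_neq0.
apply: (@le_trans _ _ (\sum_(i < (N.+1 - j).+1)
    (2 ^+ j / 2 ^+ N.+1 * M j) * 2^-1 ^+ i)); last first.
  rewrite -mulr_sumr ler_wpM2l ?half_geometric_sum//.
  by rewrite mulr_ge0 ?(ltW (M_gt0 _))// divr_ge0.
apply: ler_sum => i _.
have ji : (j + i <= N.+1)%N by rewrite -leq_subRL ?leqW// -ltnS.
apply: (@le_trans _ _ ((b N / 4) ^+ i * d i)).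
  rewrite ler_wpM2r ?lerXn2r ?nnegrE//; last first.
    by rewrite divr_ge0// (ltW (b_gt0 _)).
  by rewrite mulr_ge0 ?(ltW (M_gt0 _))// divr_ge0.
have -> : (b N / 4) ^+ i * d i =
    (2 ^+ j / 2 ^+ N.+1 * 2^-1 ^+ i) * (b N ^+ i * M (j + i)%N).
  rewrite /d exprMn exprD.
  have -> : 4^-1 ^+ i = 2^-1 ^+ i * 2^-1 ^+ i :> R.
    by rewrite -exprMn; congr (_ ^+ _); field.
  rewrite !exprVn; field; by rewrite !expf_neq0.
rewrite [leRHS]mulrAC ler_wpM2l ?M_geometric//.
Qed.

Let below_iter L k t : 0 <= t -> t <= \sum_(l < L) b (k + l)%N / 4 -> below k t.
Proof.
elim: L k t => [|L IH] k t t0.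
  rewrite big_ord0 => t0'; have -> : t = 0 by apply/le_anti/andP.
  by move=> j _; apply: A_init; rewrite mulr_gt0// divr_gt0// exprn_gt0.
rewrite big_ord_recl addn0 /bump/= => tle.
(* The last stretch of time, of length at most [b k / 4], pays for the passage from level [k + 1] to
   level [k]; the earlier time is left to the induction. *)
have tE : t = (t - Num.min t (b k / 4)) + Num.min t (b k / 4).
  by rewrite subrK.
have m0 : 0 <= Num.min t (b k / 4).
  by rewrite le_min t0 divr_ge0 ?(ltW (b_gt0 _)).
have tm : 0 <= t - Num.min t (b k / 4) by rewrite subr_ge0 ge_min lexx.
rewrite tE; apply: below_step => //; first by rewrite ge_min lexx orbT.
apply: IH => //.
under eq_bigr do rewrite addSnnS.
have [tb|tb] := leP t (b k / 4); last by rewrite lerBlDl.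
rewrite subrr sumr_ge0// => i _.
by rewrite divr_ge0 ?(ltW (b_gt0 _)).
Qed.

(* Bang's argument for the Denjoy-Carleman theorem: climbing one level
   [2 ^- N] costs a time at least [M N / M N.+1 / 4], and these times have a
   divergent sum, so that starting from level [oo] at time [0] every level is
   still valid at time [t]. *)
Lemma bang t e : 0 <= t -> 0 < e -> A 0 t e.
Proof.
move=> t0 e0.
have [k ke] : exists k : nat, M 0 / 2 ^+ k <= e.
  exists (Num.bound (M 0 / e)).
  have := archi_boundP (ltW (divr_gt0 (M_gt0 0) e0)); move: (Num.bound _) => k kb.
  rewrite ler_pdivrMr ?exprn_gt0// -ler_pdivrMl// mulrC.
  apply: (le_trans (ltW kb)); rewrite -natrX ler_nat.
  exact/ltnW/ltn_expl.
(* Level [k] is reached from level [k + N], using only ratios of index at least [k], so the partial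
   sum must also outweigh its first [k] terms. The 4 is that of the step length. *)
have [N bN] := M_div (4 * t + \sum_(l < k) b l).
apply: A_mono ke _.
have /(_ 0%N isT) : below k t; last by rewrite expr0 mulrAC mul1r.
apply: (@below_iter N) => //.
rewrite -mulr_suml ler_pdivlMr// mulrC -(lerD2r (\sum_(l < k) b l)).
apply: le_trans bN _.
have -> : \sum_(l < N) b (k + l)%N + \sum_(l < k) b l = \sum_(l < k + N) b l.
  by rewrite big_split_ord/= addrC.
rewrite addnC big_split_ord/= lerDl sumr_ge0// => i _; exact/ltW/b_gt0.
Qed.

End Bang.

(** * Carleman's inequality and weight sequences *)

(** Induction through [(1 + 1/m)^m <= e]. This is the source of the constant [e] in Carleman's
    inequality. *)
Lemma expn_le_expR_fact (R : realType) (m : nat) :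
  m%:R ^+ m <= expR 1 ^+ m * m`!%:R :> R.
Proof.
elim: m => [|m IH]; first by rewrite !expr0 mul1r.
have [->|m0] := eqVneq m 0%N.
  by rewrite !expr1 mulr1; apply: le_trans (expR_ge1Dx 1); rewrite lerDl.
have mR : 0 < m%:R :> R by rewrite ltr0n lt0n.
have step : m.+1%:R ^+ m <= expR 1 * m%:R ^+ m :> R.
  have -> : m.+1%:R = m%:R * (1 + m%:R^-1) :> R.
    by rewrite -natr1; field; rewrite gt_eqF.
  rewrite exprMn mulrC ler_wpM2r ?exprn_ge0 ?ler0n//.
  apply: (@le_trans _ _ (expR (m%:R^-1) ^+ m)).
    by rewrite lerXn2r ?nnegrE ?expR_ge0 ?addr_ge0 ?invr_ge0 ?ler0n// expR_ge1Dx.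
  by rewrite -expRM_natl mulfV ?gt_eqF.
rewrite exprS factS natrM exprS.
apply: (@le_trans _ _ (m.+1%:R * (expR 1 * (expR 1 ^+ m * m`!%:R)))).
  rewrite ler_wpM2l ?ler0n//; apply: le_trans step _.
  by rewrite ler_wpM2l ?expR_ge0.
by rewrite le_eqVlt; apply/orP; left; apply/eqP; ring.
Qed.

(** AM-GM is applied to the numbers [(k + 1) * b k]: their product contributes [m!], which is at
    least [(m/e)^m], and their partial sums [T m] can be summed by parts. The 2 in [2 e] comes from
    replacing [1/(m+1)^2] by [2/((m+1)(m+2))]. *)
Lemma carleman_inequality (R : realType) (a b : nat -> R) (n : nat) :
  (forall k, 0 <= b k) -> (forall m, 0 <= a m) ->
  (forall m, a m ^+ m <= \prod_(k < m) b k) ->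
  \sum_(m < n) a m.+1 <= 2 * expR 1 * \sum_(k < n) b k.
Proof.
move=> b0 a0 ab; set T := fun m => \sum_(k < m) k.+1%:R * b k.
have T0 m : 0 <= T m by rewrite sumr_ge0// => i _; rewrite mulr_ge0.
have e0 : 0 < expR 1 :> R := expR_gt0 1.
have agm m : a m.+1 <= 2 * expR 1 * (T m.+1 / (m.+1%:R * m.+2%:R)).
  have m1 : 0 < m.+1%:R :> R by rewrite ltr0n.
  have m2 : 0 < m.+2%:R :> R by rewrite ltr0n.
  have : (m.+1%:R / expR 1 * a m.+1) ^+ m.+1 <= (T m.+1 / m.+1%:R) ^+ m.+1.
    have /= := @leif_AGM R 'I_m.+1 predT (fun k : 'I_m.+1 => k.+1%:R * b k).
    rewrite cardT size_enum_ord => -[]; first by move=> i _; rewrite mulr_ge0.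
    move=> H _; apply: le_trans H.
    have -> : \prod_(k < m.+1) (k.+1%:R * b k) = m.+1`!%:R * \prod_(k < m.+1) b k.
      by rewrite big_split/= -natr_prod fact_prod big_add1 big_mkord.
    rewrite exprMn ler_pM ?exprn_ge0 ?divr_ge0 ?(ltW e0)//.
    by rewrite expr_div_n ler_pdivrMr ?exprn_gt0// mulrC expn_le_expR_fact.
  rewrite ler_pXn2r ?nnegrE ?mulr_ge0 ?invr_ge0 ?(ltW e0) ?T0//.
  rewrite mulrAC ler_pdivrMr// mulrC -ler_pdivlMr// => H.
  apply: (le_trans H).
  have -> : T m.+1 / m.+1%:R * expR 1 / m.+1%:R =
      expR 1 * T m.+1 / m.+1%:R * m.+1%:R^-1.
    by field; rewrite gt_eqF.
  have -> : 2 * expR 1 * (T m.+1 / (m.+1%:R * m.+2%:R)) =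
      expR 1 * T m.+1 / m.+1%:R * (2 / m.+2%:R).
    by field; rewrite !gt_eqF.
  rewrite ler_wpM2l ?mulr_ge0 ?invr_ge0 ?(ltW e0) ?T0//.
  rewrite ler_pdivlMr// ler_pdivrMl// -natrM ler_nat.
    by rewrite mulnC mul2n -addnn addnS ltnS leq_addr.
apply: (@le_trans _ _ (\sum_(m < n) 2 * expR 1 * (T m.+1 / (m.+1%:R * m.+2%:R)))).
  by apply: ler_sum => i _; exact: agm.
rewrite -mulr_sumr ler_wpM2l ?mulr_ge0 ?(ltW e0)//.
(* Summation by parts, with [1/((m+1)(m+2)) = 1/(m+1) - 1/(m+2)]. *)
suff -> : \sum_(m < n) T m.+1 / (m.+1%:R * m.+2%:R) =
    \sum_(k < n) b k - T n / n.+1%:R.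
  by rewrite gerBl divr_ge0.
elim: n => [|n IH]; first by rewrite /T !big_ord0 mul0r subrr.
rewrite !big_ord_recr/= IH /T big_ord_recr/= -/(T n).
have -> : n.+2%:R = n%:R + 2 :> R by rewrite -addn2 natrD.
rewrite -natr1; field.
by rewrite natr1 -natrD pnatr_eq0 addn2 pnatr_eq0.
Qed.

(** * From divergent roots to divergent ratios *)

Section RootSequence.
Context (R : realType) (U r M : nat -> R) (Q : nat).
Hypothesis Q_gt0 : (0 < Q)%N.
Hypothesis U0 : U 0 = 1.
Hypothesis U_roots : forall a b, (a <= b)%N -> U a ^+ b <= U b ^+ a.
Hypothesis U_logconvex : forall m s, U (m + s)%N ^+ 2 <= U m * U (m + s + s)%N.
Hypothesis r_ge1 : forall m, 1 <= r m.
Hypothesis rX : forall m, r m ^+ m = U m.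
Hypothesis M_gt0 : forall j, 0 < M j.
Hypothesis MX : forall j, M j ^+ Q = U (Q * j)%N.

Lemma root_seq_logconvex (j : nat) : M j.+1 ^+ 2 <= M j * M j.+2.
Proof.
rewrite -(@ler_pXn2r _ Q) ?nnegrE ?exprn_ge0 ?mulr_ge0 ?(ltW (M_gt0 _))//.
rewrite -exprM mulnC exprM exprMn !MX !mulnS.
by rewrite [(Q + (Q + _))%N]addnC [(Q + Q * j)%N]addnC U_logconvex.
Qed.

Let r_gt0 m : 0 < r m. Proof. exact: lt_le_trans (r_ge1 m). Qed.

Let r_mono a b : (0 < a)%N -> (a <= b)%N -> r a <= r b.
Proof.
move=> a0 ab; have ab0 : (0 < a * b)%N by rewrite muln_gt0 a0 (leq_trans a0).
rewrite -(@ler_pXn2r _ (a * b)) ?nnegrE ?(ltW (r_gt0 _))//.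
by rewrite {1}exprM rX mulnC exprM rX U_roots.
Qed.

(** Carleman's inequality with [b k = M k / M k.+1] and [a m = 1 / r (Q m)]: the product of the
    [b k] telescopes to [1 / M m], and [r (Q m) ^ m = M m] because both sides have the same [Q]-th
    power [U (Q m)]. *)
Lemma root_seq_div :
  (forall B, exists N : nat, B <= \sum_(m < N) (r m.+1)^-1) ->
  forall B, exists N : nat, B <= \sum_(k < N) M k / M k.+1.
Proof.
move=> r_div B; pose s n := \sum_(m < n) (r (Q * m.+1)%N)^-1.
have M0 : M 0 = 1.
  apply/eqP; rewrite -(@eqrXn2 _ Q)// ?ltW//.
  by rewrite MX muln0 U0 expr1n.
(* The series is cut into blocks of [Q] terms. By monotonicity of [r], each block is at most [Q]
   times a term whose index is a multiple of [Q]; the initial [Q] bounds the first block by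
   [r >= 1]. *)
have blk n : \sum_(m < Q * n.+1) (r m.+1)^-1 <= Q%:R + Q%:R * s n.
  elim: n => [|n IH].
    rewrite muln1 /s big_ord0 mulr0 addr0.
    apply: (@le_trans _ _ (\sum_(m < Q) 1)).
      by apply: ler_sum => i _; rewrite invf_le1.
    by rewrite sumr_const card_ord.
  rewrite mulnS addnC big_split_ord/= /s big_ord_recr/= mulrDr addrA.
  apply: lerD => //.
  apply: (@le_trans _ _ (\sum_(m < Q) (r (Q * n.+1)%N)^-1)).
    apply: ler_sum => i _; rewrite lef_pV2 ?posrE ?r_gt0// r_mono//.
      by rewrite muln_gt0 Q_gt0.
    by rewrite -addnS leq_addr.
  by rewrite sumr_const card_ord mulr_natl.
have [N BN] := r_div (Q%:R + Q%:R * (2 * expR 1 * B)).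
exists N; rewrite -(@ler_pM2l _ (2 * expR 1)) ?mulr_gt0 ?expR_gt0//.
apply: (@le_trans _ _ (s N)); last first.
  apply: (@carleman_inequality R (fun m => (r (Q * m)%N)^-1)
    (fun k => M k / M k.+1)).
  - by move=> k; rewrite divr_ge0// ltW.
  - by move=> m; rewrite invr_ge0 ltW.
  move=> m; have -> : \prod_(k < m) (M k / M k.+1) = (M m)^-1.
    elim: m => [|m IH]; first by rewrite big_ord0 M0 invr1.
    by rewrite big_ord_recr/= IH mulrA mulVf ?mul1r// gt_eqF.
  rewrite exprVn lef_pV2 ?posrE ?exprn_gt0//.
  rewrite -(@ler_pXn2r _ Q) ?nnegrE ?exprn_ge0 ?(ltW (M_gt0 _))//;
    last by rewrite ltW.
  by rewrite MX -exprM mulnC rX.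
rewrite -(@ler_pM2l _ Q%:R) ?ltr0n// -(lerD2l Q%:R).
apply: (le_trans BN); apply: le_trans (blk N).
have NQ : (N <= Q * N.+1)%N by rewrite mulnS (leq_trans _ (leq_addl _ _))// leq_pmull.
rewrite -(subnKC NQ) big_split_ord/= lerDl sumr_ge0// => i _.
by rewrite invr_ge0 ltW.
Qed.

End RootSequence.

(** * Suprema of powers against a weight bounded by 1 *)

Section WeightSequence.
Context (R : realType) (X : Type) (x0 : X) (y z : X -> R).
Hypothesis z_ge0 : forall x, 0 <= z x.
Hypothesis z_le1 : forall x, z x <= 1.
Hypothesis yz_bounded :
  forall m : nat, exists B, forall x, `|y x| ^+ m * z x <= B.

(** The floor 1 makes every root of the sequence at least 1, even where [y * z] is small or
    vanishes, and turns the value at [m = 0] into exactly 1. *)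
Definition weight_seq (m : nat) : R :=
  sup (range (fun x => Num.max 1 (`|y x| ^+ m * z x))).

Let yz_ge0 m x : 0 <= `|y x| ^+ m * z x.
Proof. by rewrite mulr_ge0. Qed.

Lemma weight_seq_has_sup (m : nat) :
  has_sup (range (fun x => Num.max 1 (`|y x| ^+ m * z x))).
Proof.
have [B BP] := yz_bounded m; split; first by exists (Num.max 1 (`|y x0| ^+ m * z x0)), x0.
exists (Num.max 1 B) => _ [x _ <-]; rewrite ge_max le_max lexx/= le_max.
by rewrite BP orbT.
Qed.

Lemma weight_seq_ub (m : nat) (x : X) :
  Num.max 1 (`|y x| ^+ m * z x) <= weight_seq m.
Proof. by apply: ub_le_sup; [case: (weight_seq_has_sup m)|exists x]. Qed.

Lemma weight_seq_ge1 (m : nat) : 1 <= weight_seq m.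
Proof. by apply: le_trans (weight_seq_ub m x0); rewrite le_max lexx. Qed.

Lemma weight_seq_ge (m : nat) (x : X) : `|y x| ^+ m * z x <= weight_seq m.
Proof. by apply: le_trans (weight_seq_ub m x); rewrite le_max lexx orbT. Qed.

(** Moves a power inside the supremum, by comparing with the [b]-th root of [B]; the inequalities
    between the terms of the sequence then reduce to pointwise ones. *)
Lemma weight_seq_expr_le (m b : nat) (B : R) : (0 < b)%N -> 1 <= B ->
  (forall x, (`|y x| ^+ m * z x) ^+ b <= B) -> weight_seq m ^+ b <= B.
Proof.
move=> b0 B1 HB; have B0 : 0 <= B := le_trans ler01 B1.
have rb : (B `^ (b%:R^-1)) ^+ b = B.
  by rewrite -powR_mulrn ?powR_ge0// -powRrM mulVf ?powRr1// pnatr_eq0 -lt0n.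
rewrite -[leRHS]rb lerXn2r ?nnegrE ?powR_ge0//.
  by rewrite (le_trans ler01)// weight_seq_ge1.
apply: sup_le_ub; first by case: (weight_seq_has_sup m).
move=> _ [x _ <-]; rewrite ge_max; apply/andP; split.
  by rewrite -(@ler_pXn2r _ b)// ?nnegrE ?powR_ge0// rb expr1n.
by rewrite -(@ler_pXn2r _ b)// ?nnegrE ?powR_ge0// rb.
Qed.

Lemma weight_seq0 : weight_seq 0 = 1.
Proof.
apply/le_anti; rewrite weight_seq_ge1 andbT -[weight_seq 0]expr1.
by apply: weight_seq_expr_le => // x; rewrite expr1 expr0 mul1r.
Qed.

(** Both [(|y|^a z)^b] and [(|y|^b z)^a] contain [|y|^(ab)], and [z^b <= z^a] since [0 <= z <= 1].
    In other words, the [m]-th roots are nondecreasing. *)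
Lemma weight_seq_roots (a b : nat) : (a <= b)%N ->
  weight_seq a ^+ b <= weight_seq b ^+ a.
Proof.
case: b => [|b] ab.
  by move: ab; rewrite leqn0 => /eqP ->.
apply: weight_seq_expr_le => // [|x].
  by rewrite exprn_ege1 ?weight_seq_ge1.
apply: (@le_trans _ _ ((`|y x| ^+ b.+1 * z x) ^+ a)).
  rewrite !exprMn -!exprM mulnC ler_wpM2l ?exprn_ge0//.
  by apply: ler_wiXn2l.
by rewrite lerXn2r ?nnegrE ?weight_seq_ge// (le_trans ler01) ?weight_seq_ge1.
Qed.

(** Pointwise an equality between powers of [|y|] and [z]. The stride [s] is general because the
    sequence is later sampled at the multiples of [Q]. *)
Lemma weight_seq_logconvex (m s : nat) :
  weight_seq (m + s) ^+ 2 <= weight_seq m * weight_seq (m + s + s).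
Proof.
apply: weight_seq_expr_le => // [|x].
  by rewrite mulr_ege1 ?weight_seq_ge1.
apply: (@le_trans _ _ ((`|y x| ^+ m * z x) * (`|y x| ^+ (m + s + s) * z x))).
  by rewrite le_eqVlt !exprD; apply/orP; left; apply/eqP; ring.
by rewrite ler_pM ?weight_seq_ge.
Qed.

End WeightSequence.

Lemma nneseries_le_real (R : realType) (t : nat -> \bar R) (s : nat -> R) (B : R) :
  (forall m, (0 < m)%N -> 0 <= t m)%E ->
  (forall m, (0 < m)%N -> (t m <= (s m)%:E)%E) ->
  (forall n, \sum_(1 <= m < n) s m <= B) ->
  (\sum_(1 <= m <oo) t m <= B%:E)%E.
Proof.
move=> t0 ts sB; apply: lime_le; first by apply: is_cvg_nneseries => n n1 _; exact: t0.
apply: nearW => n; apply: (@le_trans _ _ (\sum_(1 <= m < n) (s m)%:E)%E).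
  by rewrite big_nat_cond [leRHS]big_nat_cond lee_sum// => m /andP[/andP[m1 _] _]; exact: ts.
by rewrite sumEFin lee_fin.
Qed.

Lemma sum_nat_le_prefix (R : realType) (s : nat -> R) (m0 : nat) :
  (forall m, 0 <= s m) -> (forall m, (m0 <= m)%N -> s m = 0) ->
  forall n, \sum_(1 <= m < n) s m <= \sum_(m < m0) s m.
Proof.
move=> s0 sm0 n; apply: (@le_trans _ _ (\sum_(0 <= m < n + m0) s m)).
  case: n => [|n]; first by rewrite big_geq// sumr_ge0.
  rewrite [leRHS](@big_cat_nat _ _ _ n.+1)//= ?leq_addr//.
  by rewrite [in leRHS]big_ltn// -addrA addrCA lerDl addr_ge0// sumr_ge0.
rewrite (@big_cat_nat _ _ _ m0)//= ?leq_addl// big_mkord gerDl.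
by rewrite big_nat_cond big1// => i /andP[/andP[+ _] _]; exact: sm0.
Qed.

(** * Boundedness and divergence from the quasi-analytic condition *)

Section QuasiAnalyticWeight.
Context (R : realType) (X : Type) (x0 : X) (y w : X -> R) (C : R).
Hypothesis C_ge1 : 1 <= C.
Hypothesis w_ge0 : forall x, 0 <= w x.
Hypothesis w_leC : forall x, w x <= C.

Let T m := ereal_sup [set `|(y x ^+ m * w x)%:E|%E | x in setT].
Let t m := ((T m `^ (m%:R^-1))^-1)%E.

Hypothesis t_div : (\sum_(1 <= m <oo) t m = +oo)%E.

Let z x := w x / C.

Let C_gt0 : 0 < C. Proof. exact: lt_le_trans C_ge1. Qed.

Let T_ge m x : ((`|y x| ^+ m * w x)%:E <= T m)%E.
Proof.
apply: ereal_sup_ubound; exists x => //=.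
by rewrite normrM normrX [`|w x|]ger0_norm.
Qed.

Let T_ge0 m : (0 <= T m)%E.
Proof. by apply: le_trans (T_ge m x0); rewrite lee_fin mulr_ge0. Qed.

Let t_ge0 m : (0 <= t m)%E.
Proof. by rewrite inve_ge0 poweR_ge0. Qed.

Let t_lty x m : y x * w x != 0 -> (t m < +oo)%E.
Proof.
rewrite mulf_eq0 negb_or => /andP[yx wx].
rewrite lt_neqAle leey andbT inve_eqy gt_eqF// poweR_gt0//.
apply: lt_le_trans (T_ge m x); rewrite lte_fin mulr_gt0//.
  by rewrite exprn_gt0// normr_gt0.
by rewrite lt_neqAle eq_sym wx w_ge0.
Qed.

Let fine_t_ge0 m : 0 <= fine (t m). Proof. exact: fine_ge0. Qed.

(** If [T m] is infinite, so is [T k] for all [k > m], because [w <= C] controls the points with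
    [|y| < 1]. All terms beyond [m] are then 0 and the earlier ones are finite, so the series could
    not diverge. *)
Lemma qa_weight_bounded (m : nat) : exists B, forall x, `|y x| ^+ m * w x <= B.
Proof.
have [Tm|Tm] := eqVneq (T m) +oo%E; last first.
  exists (fine (T m)) => x; rewrite -lee_fin fineK ?T_ge//.
  by rewrite ge0_fin_numE// lt_neqAle Tm leey.
case: m Tm => [|m] Tm; first by exists C => x; rewrite expr0 mul1r.
have Ty k : (m < k)%N -> T k = +oo%E.
  move=> mk; apply: eq_infty => B.
  have : ((B + C)%:E < T m.+1)%E by rewrite Tm ltry.
  move=> /ereal_sup_gt[_ [x _ <-]]; rewrite lte_fin => BC.
  apply: le_trans (T_ge k x); rewrite lee_fin.
  rewrite -(lerD2r C); apply/ltW/(lt_le_trans BC).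
  rewrite normrM normrX [`|w x|]ger0_norm//.
  have [y1|y1] := leP 1 `|y x|.
    rewrite -[leLHS]addr0 lerD ?(ltW C_gt0)// ler_wpM2r//.
    by rewrite -(subnKC mk) exprD ler_peMr// exprn_ege1.
  apply: (@le_trans _ _ C); last by rewrite lerDr mulr_ge0.
  by apply: le_trans (w_leC x); rewrite ler_piMl// exprn_ile1// ltW.
(* A point where [y * w] is nonzero excludes [T k = 0], hence the terms [1/0 = +oo]. *)
have [x1 yw] : exists x, y x * w x != 0.
  have : (0%:E < T m.+1)%E by rewrite Tm ltry.
  move=> /ereal_sup_gt[_ [x2 _ <-]]; rewrite lte_fin normr_gt0 => H.
  by exists x2; move: H; rewrite !mulf_eq0 !negb_or expf_eq0 => /andP[? ?]; apply/andP.
have : (+oo <= (\sum_(k < m.+1) (if (k < m.+1)%N then fine (t k) else 0))%:E)%E :> Prop.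
  rewrite -[leLHS]t_div; apply: (@nneseries_le_real _ _
    (fun k => if (k < m.+1)%N then fine (t k) else 0)) => // [k k0|].
    case: ifPn => km; first by rewrite fineK// ge0_fin_numE// (t_lty _ yw).
    by rewrite /t Ty ?ltnNge ?poweRyr// ?invey ?invr_eq0 ?pnatr_eq0 -?lt0n -?ltnNge -?leqNgt// leqNgt.
  apply: sum_nat_le_prefix => k; first by case: ifP.
  by rewrite leqNgt => /negbTE ->.
by rewrite leye_eq.
Qed.

Lemma normalized_weight_bounded (m : nat) :
  exists B, forall x, `|y x| ^+ m * z x <= B.
Proof.
have [B HB] := qa_weight_bounded m; exists (B / C) => x.
by rewrite /z mulrA ler_pM2r ?invr_gt0.
Qed.

Let z_ge0 x : 0 <= z x. Proof. by rewrite divr_ge0// ltW. Qed.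
Let z_le1 x : z x <= 1. Proof. by rewrite ler_pdivrMr// mul1r. Qed.

Let U := weight_seq y z.
Let r m := U m `^ (m%:R^-1).

Let U_ge1 m : 1 <= U m.
Proof. exact: (weight_seq_ge1 x0 normalized_weight_bounded). Qed.

(** Once some [U] exceeds 1, all later ones do by [weight_seq_roots]; the floor is then inactive, so
    [U m <= T m] because [C >= 1], and [1 / r m] dominates the original term. The finitely many
    earlier terms are finite and do not affect divergence. *)
Lemma qa_weight_seq_div :
  forall B, exists N : nat, B <= \sum_(m < N) (r m.+1)^-1.
Proof.
move=> B; apply/not_existsP => HB.
have {}HB N : \sum_(m < N) (r m.+1)^-1 < B.
  by have /negP := HB N; rewrite -ltNge.
have r_gt0 m : 0 < r m by rewrite powR_gt0// (lt_le_trans ltr01).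
(* If no [U] exceeded 1, all roots would be 1 and the partial sums would be unbounded anyway. *)
have [m0 Um0] : exists m0, 1 < U m0.+1.
  apply/not_existsP => U1.
  have := HB (Num.bound B); rewrite ltNge => /negP; apply.
  apply: (@le_trans _ _ (\sum_(m < Num.bound B) 1)).
    rewrite sumr_const card_ord; have [B0|B0] := leP 0 B.
      exact/ltW/archi_boundP.
    by rewrite (le_trans (ltW B0)).
  apply: ler_sum => m _; have -> : r m.+1 = 1; last by rewrite invr1.
  rewrite /r; have -> : U m.+1 = 1; last by rewrite powR1.
  by apply/le_anti; rewrite U_ge1 andbT leNgt; apply/negP/U1.
have U_gt1 m : (m0 < m)%N -> 1 < U m.
  move=> m0m; have m_gt0 : (0 < m)%N by rewrite (leq_trans _ m0m).
  have H : U m0.+1 ^+ m <= U m ^+ m0.+1.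
    exact: (weight_seq_roots x0 z_ge0 z_le1 normalized_weight_bounded).
  rewrite ltNge; apply/negP => Um1.
  have : U m0.+1 ^+ m <= 1.
    by apply: le_trans H _; rewrite exprn_ile1// (le_trans ler01).
  by rewrite leNgt => /negP; apply; rewrite exprn_egt1//; case: (m) m_gt0.
have U_leT m : (m0 < m)%N -> ((U m)%:E <= T m)%E.
  move=> m0m; have Tfin : (fine (T m))%:E = T m.
    have [b Hb] := qa_weight_bounded m; rewrite fineK// ge0_fin_numE//.
    apply: (@le_lt_trans _ _ b%:E); last by rewrite ltry.
    apply: ge_ereal_sup => _ [x _ <-].
    by rewrite lee_fin normrM normrX [`|w x|]ger0_norm.
  rewrite -Tfin lee_fin leNgt; apply/negP => TU.
  have : U m ^+ 1 <= Num.max 1 (fine (T m)).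
    apply: (weight_seq_expr_le x0 z_ge0 normalized_weight_bounded) => // [|x].
      by rewrite le_max lexx.
    rewrite expr1 le_max; apply/orP; right.
    apply: (@le_trans _ _ (`|y x| ^+ m * w x)).
      by rewrite ler_wpM2l ?exprn_ge0// /z ler_pdivrMr// ler_peMr.
    by rewrite -lee_fin Tfin.
  by rewrite expr1 leNgt gt_max TU U_gt1.
have [x yw] : exists x, y x * w x != 0.
  apply/not_existsP => yw0.
  have : U m0.+1 ^+ 1 <= 1.
    apply: (weight_seq_expr_le x0 z_ge0 normalized_weight_bounded) => // x.
    have /negP := yw0 x; rewrite negbK expr1 /z mulrA.
    rewrite mulf_eq0 => /orP[]/eqP ->; rewrite ?normr0 ?exprS ?mul0r ?mulr0 ?mul0r //.
  by rewrite expr1 leNgt Um0.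
have : (+oo <= (\sum_(k < m0.+1) (if (k < m0.+1)%N then fine (t k) else 0) + B)%:E)%E :> Prop.
  rewrite -[leLHS]t_div; apply: (@nneseries_le_real _ _
    (fun k => (if (k < m0.+1)%N then fine (t k) else 0) + (r k)^-1)) => // [k k0|n].
    case: ifPn => km.
      rewrite EFinD fineK ?ge0_fin_numE ?(t_lty _ yw)//.
      by rewrite leeDl// lee_fin invr_ge0 ltW.
    rewrite add0r; rewrite -leqNgt in km.
    have -> : ((r k)^-1)%:E = ((U k)%:E `^ (k%:R^-1))^-1%E.
      by rewrite poweR_EFin -/(r k) inver gt_eqF.
    rewrite /t lee_pV2 ?inE ?poweR_ge0//.
    apply: gt0_ler_poweR; rewrite ?invr_ge0 ?in_itv/= ?leey ?andbT ?T_ge0//.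
      by rewrite lee_fin (le_trans ler01).
    exact: U_leT.
  rewrite big_split/= lerD//.
    apply: (@sum_nat_le_prefix _ _ m0.+1) => k; first by case: ifP.
    by rewrite leqNgt => /negbTE ->.
  case: n => [|n]; first by rewrite big_geq// ltW// (le_lt_trans _ (HB 0%N))// big_ord0.
  by rewrite big_add1/= big_mkord ltW.
by rewrite leye_eq.
Qed.

End QuasiAnalyticWeight.

(** * The L_p seminorm of complex functions *)

Section ComplexNorm.
Context (R : realType).
Implicit Types (x y : R[i]) (r : R).

Lemma normr_complex x : `|x| = (normc x)%:C%C. Proof. by []. Qed.

Lemma normc_ge0 x : 0 <= normc x.
Proof. by rewrite -ler0c -normr_complex. Qed.

Lemma normcD_le x y : normc (x + y) <= normc x + normc y.
Proof. by rewrite -lecR rmorphD/= -!normr_complex ler_normD. Qed.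

Lemma normc_real r : normc r%:C%C = `|r|.
Proof. by rewrite /= expr0n/= addr0 sqrtr_sqr. Qed.

Lemma normcN x : normc (- x) = normc x.
Proof. by case: x => a b /=; rewrite !sqrrN. Qed.

Lemma Re_le_normc x : `|complex.Re x| <= normc x.
Proof. by case: x => a b /=; rewrite -sqrtr_sqr ler_wsqrtr// lerDl sqr_ge0. Qed.

Lemma Im_le_normc x : `|complex.Im x| <= normc x.
Proof. by case: x => a b /=; rewrite -sqrtr_sqr ler_wsqrtr// lerDr sqr_ge0. Qed.

Lemma normc_le_ReIm x : normc x <= `|complex.Re x| + `|complex.Im x|.
Proof.
case: x => a b /=; rewrite -[leRHS]ger0_norm ?addr_ge0// -sqrtr_sqr ler_wsqrtr//.
by rewrite sqrrD !real_normK ?num_real// -addrA addrCA lerDr mulrn_wge0 ?mulr_ge0.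
Qed.

End ComplexNorm.

Section ComplexMeasurable.
Context d (T : measurableType d) (R : realType).
Implicit Types (f g : T -> R[i]).

Lemma measurable_fun_powR (u : T -> R) (p : R) :
  measurable_fun setT u -> measurable_fun setT (fun x => u x `^ p).
Proof. exact: (@measurableT_comp _ _ _ _ _ _ (@powR R ^~ p)). Qed.

Definition cmeasurable f := measurable_fun setT (fun x => complex.Re (f x)) /\
  measurable_fun setT (fun x => complex.Im (f x)).

Lemma cmeasurable_real (u : T -> R) : measurable_fun setT u ->
  cmeasurable (fun x => (u x)%:C%C).
Proof. by move=> mu; split=> //=; apply: measurable_cst. Qed.

Lemma cmeasurable_complex (u v : T -> R) : measurable_fun setT u ->
  measurable_fun setT v -> cmeasurable (fun x => u x +i* v x)%C.
Proof. by []. Qed.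

Lemma cmeasurable_cst (c : R[i]) : cmeasurable (fun=> c).
Proof. by split; apply: measurable_cst. Qed.

Lemma cmeasurableD f g : cmeasurable f -> cmeasurable g ->
  cmeasurable (fun x => f x + g x).
Proof.
move=> [f1 f2] [g1 g2]; split.
  rewrite (_ : (fun _ => _) = (fun x => complex.Re (f x)) \+ (fun x => complex.Re (g x))).
    exact: measurable_funD.
  by apply/funext => x /=; case: (f x) (g x) => a b [].
rewrite (_ : (fun _ => _) = (fun x => complex.Im (f x)) \+ (fun x => complex.Im (g x))).
  exact: measurable_funD.
by apply/funext => x /=; case: (f x) (g x) => a b [].
Qed.

Lemma cmeasurableM f g : cmeasurable f -> cmeasurable g ->
  cmeasurable (fun x => f x * g x).
Proof.
move=> [f1 f2] [g1 g2]; split.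
  rewrite (_ : (fun _ => _) = ((fun x => complex.Re (f x)) \* (fun x => complex.Re (g x))) \-
     ((fun x => complex.Im (f x)) \* (fun x => complex.Im (g x)))).
    by apply: measurable_funB; apply: measurable_funM.
  by apply/funext => x /=; case: (f x) (g x) => a b [].
rewrite (_ : (fun _ => _) = ((fun x => complex.Re (f x)) \* (fun x => complex.Im (g x))) \+
   ((fun x => complex.Im (f x)) \* (fun x => complex.Re (g x)))).
  by apply: measurable_funD; apply: measurable_funM.
by apply/funext => x /=; case: (f x) (g x) => a b [].
Qed.

Lemma cmeasurableZ (c : R[i]) f : cmeasurable f -> cmeasurable (fun x => c * f x).
Proof. by move=> mf; apply: cmeasurableM => //; exact: cmeasurable_cst. Qed.

Lemma cmeasurableB f g : cmeasurable f -> cmeasurable g ->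
  cmeasurable (fun x => f x - g x).
Proof.
move=> mf mg; have := cmeasurableD mf (cmeasurableZ (-1) mg).
by under eq_fun do rewrite mulN1r.
Qed.

Lemma cmeasurable_sum (m : nat) (F : 'I_m -> T -> R[i]) :
  (forall i, cmeasurable (F i)) -> cmeasurable (fun x => \sum_(i < m) F i x).
Proof.
elim: m F => [|m IH] F mF.
  by under eq_fun do rewrite big_ord0; exact: cmeasurable_cst.
under eq_fun do rewrite big_ord_recl.
by apply: cmeasurableD => //; apply: (IH (fun i => F (lift ord0 i))).
Qed.

Lemma cmeasurable_normc f : cmeasurable f -> measurable_fun setT (normc \o f).
Proof.
move=> [f1 f2].
rewrite (_ : _ \o _ =
  (fun x => (complex.Re (f x) ^+ 2 + complex.Im (f x) ^+ 2) `^ (2^-1))).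
  apply: measurable_fun_powR; apply: measurable_funD;
    exact: measurable_funX.
apply/funext => x /=; case: (f x) => a b /=.
by rewrite powR12_sqrt// addr_ge0// sqr_ge0.
Qed.

End ComplexMeasurable.

Section LpSeminorm.
Context d (T : measurableType d) (R : realType).
Variables (mu : {measure set T -> \bar R}) (p : R).
Hypothesis p_ge1 : 1 <= p.
Implicit Types (f g h : T -> R[i]) (G H : T -> R).

Let p_gt0 : 0 < p. Proof. exact: lt_le_trans p_ge1. Qed.
Let p_neq0 : p != 0. Proof. by rewrite gt_eqF. Qed.

Let N G := Lnorm mu p%:E (EFin \o G).

Let NE G : (N G = (\int[mu]_x (`|G x| `^ p)%:E) `^ (p^-1))%E.
Proof.
by rewrite /N unlock; congr (_ `^ _)%E; apply: eq_integral => x _ /=; rewrite poweR_EFin.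
Qed.

Let mpow G : measurable_fun setT G ->
  measurable_fun setT (fun x => (`|G x| `^ p)%:E).
Proof.
move=> mG; apply/measurable_EFinP.
by apply: measurable_fun_powR; apply: measurableT_comp.
Qed.

Let N_le G H : measurable_fun setT G -> measurable_fun setT H ->
  (forall x, `|G x| <= `|H x|) -> (N G <= N H)%E.
Proof.
move=> mG mH GH; rewrite !NE; apply: gt0_ler_poweR; rewrite ?invr_ge0 ?(ltW p_gt0)//.
- by rewrite in_itv/= leey andbT integral_ge0// => x _; rewrite lee_fin powR_ge0.
- by rewrite in_itv/= leey andbT integral_ge0// => x _; rewrite lee_fin powR_ge0.
apply: ge0_le_integral => //; try exact: mpow.
by move=> x _; rewrite lee_fin ge0_ler_powR ?nnegrE ?(ltW p_gt0).
Qed.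

Let N_scale (c : R) G : measurable_fun setT G -> 0 <= c ->
  N (fun x => c * G x) = (c%:E * N G)%E.
Proof.
move=> mG c0; rewrite !NE.
under eq_integral do rewrite normrM (ger0_norm c0) powRM// EFinM.
rewrite ge0_integralZl//; [|exact: mpow|by rewrite lee_fin powR_ge0].
rewrite poweRM ?lee_fin ?powR_ge0//; last first.
  by rewrite integral_ge0// => x _; rewrite lee_fin powR_ge0.
by rewrite poweR_EFin -powRrM divff// powRr1.
Qed.

Lemma cLnormE f : (cLnorm mu p f = (\int[mu]_x ((normc (f x)) `^ p)%:E) `^ (p^-1))%E.
Proof.
rewrite /cLnorm -/(N (normc \o f)) NE; congr (_ `^ _)%E; apply: eq_integral => x _ /=.
by rewrite ger0_norm ?normc_ge0.
Qed.

Lemma cLnorm_ge0 f : (0 <= cLnorm mu p f)%E.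
Proof. by rewrite cLnormE poweR_ge0. Qed.

Lemma cLnorm_le f g : cmeasurable f -> cmeasurable g ->
  (forall x, normc (f x) <= normc (g x)) -> (cLnorm mu p f <= cLnorm mu p g)%E.
Proof.
move=> mf mg fg; apply: (@N_le (normc \o f) (normc \o g)).
- exact: cmeasurable_normc.
- exact: cmeasurable_normc.
by move=> x /=; rewrite !ger0_norm ?normc_ge0.
Qed.

Lemma cLnormD f g : cmeasurable f -> cmeasurable g ->
  (cLnorm mu p (fun x => f x + g x)%R <= cLnorm mu p f + cLnorm mu p g)%E.
Proof.
move=> /[dup] mf /cmeasurable_normc mf' /[dup] mg /cmeasurable_normc mg'.
apply: le_trans (minkowski_EFin mu mf' mg' p_ge1).
apply: (@N_le (fun x => normc (f x + g x)) ((normc \o f) \+ (normc \o g))).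
- exact/cmeasurable_normc/cmeasurableD.
- exact: measurable_funD.
by move=> x /=; rewrite !ger0_norm ?normc_ge0 ?addr_ge0 ?normc_ge0 ?normcD_le.
Qed.

Lemma cLnorm_leM (c : R) f g : cmeasurable f -> cmeasurable g -> 0 <= c ->
  (forall x, normc (f x) <= c * normc (g x)) ->
  (cLnorm mu p f <= c%:E * cLnorm mu p g)%E.
Proof.
move=> mf mg c0 fg; have mg' := cmeasurable_normc mg.
rewrite /cLnorm -(@N_scale c (normc \o g))//.
apply: (@N_le (normc \o f)); first exact: cmeasurable_normc.
  exact: measurable_funM.
by move=> x /=; rewrite !ger0_norm ?mulr_ge0 ?normc_ge0.
Qed.

Lemma cLnorm_lty f : cmeasurable f ->
  (cLnorm mu p f < +oo)%E = (\int[mu]_x ((normc (f x)) `^ p)%:E < +oo)%E.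
Proof.
move=> mf; rewrite cLnormE; apply/idP/idP; last exact: poweR_lty.
by apply: lty_poweRy; rewrite invr_eq0.
Qed.

Lemma cLnorm_le_real f (e : R) : 0 <= e ->
  (cLnorm mu p f <= e%:E)%E = (\int[mu]_x ((normc (f x)) `^ p)%:E <= (e `^ p)%:E)%E.
Proof.
move=> e0; rewrite cLnormE; set I := (\int[mu]_x _)%E.
have I0 : (0 <= I)%E by rewrite integral_ge0// => x _; rewrite lee_fin powR_ge0.
apply/idP/idP => H.
  rewrite -[I]poweRe1// -(mulVf p_neq0) poweRrM -poweR_EFin.
  by apply: gt0_ler_poweR; rewrite ?(ltW p_gt0) ?in_itv/= ?leey ?andbT ?poweR_ge0 ?lee_fin.
rewrite -[leRHS]poweRe1 ?lee_fin// -(divff p_neq0) poweRrM poweR_EFin.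
by apply: gt0_ler_poweR; rewrite ?invr_ge0 ?(ltW p_gt0) ?in_itv/= ?leey ?andbT ?lee_fin ?powR_ge0.
Qed.

Lemma cLnorm0 : cLnorm mu p (fun=> 0) = 0%E.
Proof.
apply/le_anti; rewrite cLnorm_ge0 andbT.
rewrite cLnorm_le_real// ComplexField.Normc.normc0 powR0//.
by rewrite integral_cst// mul0e.
Qed.

Lemma cLnorm_sum (m : nat) (F : 'I_m -> T -> R[i]) (e : 'I_m -> R) :
  (forall i, cmeasurable (F i)) ->
  (forall i, (cLnorm mu p (F i) <= (e i)%:E)%E) ->
  (cLnorm mu p (fun x => \sum_(i < m) F i x)%R <= (\sum_(i < m) e i)%:E)%E.
Proof.
elim: m F e => [|m IH] F e mF Fe.
  by under eq_fun do rewrite big_ord0; rewrite big_ord0 cLnorm0.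
under eq_fun do rewrite big_ord_recl; rewrite big_ord_recl EFinD.
apply: le_trans (cLnormD (mF _) _) _.
  by apply: (@cmeasurable_sum _ _ _ _ (fun i => F (lift ord0 i))) => i.
by apply: leeD => //; apply: (IH (fun i => F (lift ord0 i))).
Qed.

Lemma cLfunP f : cLfun mu p f <-> cmeasurable f /\ (cLnorm mu p f < +oo)%E.
Proof. by split => [[]|[[]]]. Qed.

Lemma cLfunD f g : cLfun mu p f -> cLfun mu p g -> cLfun mu p (fun x => f x + g x).
Proof.
move=> /cLfunP[mf fy] /cLfunP[mg gy]; apply/cLfunP; split; first exact: cmeasurableD.
by apply: le_lt_trans (cLnormD mf mg) _; rewrite lte_add_pinfty.
Qed.

Lemma cLfun_le (c : R) f g : cmeasurable f -> cLfun mu p g -> 0 <= c ->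
  (forall x, normc (f x) <= c * normc (g x)) -> cLfun mu p f.
Proof.
move=> mf /cLfunP[mg gy] c0 fg; apply/cLfunP; split=> //.
by apply: le_lt_trans (cLnorm_leM mf mg c0 fg) _; rewrite lte_mul_pinfty.
Qed.

Lemma cLfunZ (c : R[i]) f : cLfun mu p f -> cLfun mu p (fun x => c * f x).
Proof.
move=> Lf; apply: (@cLfun_le (normc c) _ f) => //.
- by apply: cmeasurableZ; case/cLfunP: Lf.
- exact: normc_ge0.
by move=> x; rewrite ComplexField.Normc.normcM.
Qed.

Lemma cLfunB f g : cLfun mu p f -> cLfun mu p g -> cLfun mu p (fun x => f x - g x).
Proof.
move=> Lf Lg; have := cLfunD Lf (cLfunZ (-1) Lg).
by under eq_fun do rewrite mulN1r.
Qed.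

(** * Closure of a linear subspace in the seminorm *)

Section Closure.
Variable A : set (T -> R[i]).
Hypothesis A0 : A (fun=> 0).
Hypothesis AD : forall f g, A f -> A g -> A (fun x => f x + g x).
Hypothesis AZ : forall (c : R[i]) f, A f -> A (fun x => c * f x).
Hypothesis A_Lp : A `<=` cLfun mu p.

(** An upper bound on the distance to [A], with an explicit approximant instead of an infimum; this
    is the form in which distances enter Bang's argument. *)
Definition Lp_within (e : R) f :=
  exists2 g, A g & (cLnorm mu p (fun x => f x - g x)%R <= e%:E)%E.

Definition Lp_closure f := cLfun mu p f /\ forall e, 0 < e -> Lp_within e f.

Let A_meas f : A f -> cmeasurable f.
Proof. by move=> /A_Lp/cLfunP[]. Qed.

Lemma Lp_within_mono e e' f : e <= e' -> Lp_within e f -> Lp_within e' f.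
Proof. by move=> ee' [g Ag fg]; exists g => //; rewrite (le_trans fg)// lee_fin. Qed.

Lemma Lp_within_near e e' f g : cmeasurable f -> cmeasurable g ->
  (cLnorm mu p (fun x => f x - g x)%R <= e%:E)%E -> Lp_within e' g ->
  Lp_within (e + e') f.
Proof.
move=> mf mg fg [h Ah gh]; exists h => //.
have -> : (fun x => f x - h x) = (fun x => (f x - g x) + (g x - h x)).
  by apply/funext => x; rewrite subrKA.
apply: le_trans (cLnormD _ _) _; try exact: cmeasurableB.
  by apply: cmeasurableB => //; exact: A_meas.
by rewrite EFinD leeD.
Qed.

Lemma Lp_within_sum (m : nat) (c : 'I_m -> R[i]) (F : 'I_m -> T -> R[i])
    (e : 'I_m -> R) : (forall i, cmeasurable (F i)) ->
  (forall i, Lp_within (e i) (F i)) ->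
  Lp_within (\sum_(i < m) normc (c i) * e i) (fun x => \sum_(i < m) c i * F i x).
Proof.
move=> mF FA.
have /choice[g Hg] : forall i, exists g, A g /\
    (cLnorm mu p (fun x => F i x - g x)%R <= (e i)%:E)%E.
  by move=> i; have [g] := FA i; exists g.
exists (fun x => \sum_(i < m) c i * g i x).
  have Ag i : A (g i) by case: (Hg i).
  move: g c {FA mF Hg F e} Ag; elim: m => [|m IH] g c Ag.
    by under eq_fun do rewrite big_ord0.
  under eq_fun do rewrite big_ord_recl.
  apply: AD; first exact/AZ/Ag.
  by apply: (IH (fun i => g (lift ord0 i)) (fun i => c (lift ord0 i))).
have -> : (fun x => \sum_(i < m) c i * F i x - \sum_(i < m) c i * g i x) =
    (fun x => \sum_(i < m) c i * (F i x - g i x)).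
  by apply/funext => x; rewrite -sumrB; apply: eq_bigr => i _; rewrite mulrBr.
have mFg i : cmeasurable (fun x => F i x - g i x).
  by apply: cmeasurableB => //; apply: A_meas; case: (Hg i).
apply: cLnorm_sum => i; first exact: cmeasurableZ.
apply: le_trans (cLnorm_leM _ (mFg i) (normc_ge0 (c i)) _) _.
- exact: cmeasurableZ.
- by move=> x; rewrite ComplexField.Normc.normcM.
by rewrite EFinM lee_wpmul2l ?lee_fin ?normc_ge0//; case: (Hg i).
Qed.

Lemma Lp_closure_meas f : Lp_closure f -> cmeasurable f.
Proof. by case=> /cLfunP[]. Qed.

Lemma sub_Lp_closure : A `<=` Lp_closure.
Proof.
move=> f Af; split; first exact: A_Lp.
move=> e e0; exists f => //; under eq_fun do rewrite subrr.
by rewrite cLnorm0 lee_fin ltW.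
Qed.

Lemma Lp_closureD f g : Lp_closure f -> Lp_closure g ->
  Lp_closure (fun x => f x + g x).
Proof.
move=> [Lf fA] [Lg gA]; split; first exact: cLfunD.
move=> e e0; have e20 : 0 < e / 2 by rewrite divr_gt0.
have [f' Af' ff'] := fA _ e20; have [g' Ag' gg'] := gA _ e20.
exists (fun x => f' x + g' x); first exact: AD.
under eq_fun do rewrite opprD addrACA.
rewrite [e]splitr EFinD; apply: le_trans (cLnormD _ _) (leeD ff' gg').
- by apply: cmeasurableB; [case/cLfunP: Lf|exact: A_meas].
- by apply: cmeasurableB; [case/cLfunP: Lg|exact: A_meas].
Qed.

Lemma Lp_closed f : cLfun mu p f ->
  (forall e, 0 < e -> exists2 g, Lp_closure g &
    (cLnorm mu p (fun x => f x - g x)%R <= e%:E)%E) ->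
  Lp_closure f.
Proof.
move=> /[dup] Lf /cLfunP[mf _] fK; split=> // e e0.
have e20 : 0 < e / 2 by rewrite divr_gt0.
have [g [/cLfunP[mg _] gA] fg] := fK _ e20.
by rewrite [e]splitr; apply: Lp_within_near fg (gA _ e20).
Qed.

(** Multiplication by a bounded function is continuous for the seminorm, so it suffices to test it
    on [A]. *)
Lemma Lp_closureM_bounded (c : R) (u : T -> R[i]) f : cmeasurable u ->
  (forall x, normc (u x) <= c) ->
  (forall g, A g -> Lp_closure (fun x => u x * g x)) ->
  Lp_closure f -> Lp_closure (fun x => u x * f x).
Proof.
move=> um uc uA [/[dup] Lf /cLfunP[mf _] fA].
have c0 : 0 <= Num.max 1 c by rewrite le_max ler01.
have uc' x : normc (u x) <= Num.max 1 c by rewrite le_max uc orbT.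
apply: Lp_closed => [|e e0].
  apply: (cLfun_le _ Lf c0); first exact: cmeasurableM.
  by move=> x; rewrite ComplexField.Normc.normcM ler_wpM2r ?normc_ge0.
have c1 : 0 < Num.max 1 c by rewrite lt_max ltr01.
have [g Ag fg] := fA (e / Num.max 1 c) (divr_gt0 e0 c1).
exists (fun x => u x * g x); first exact: uA.
have mfg : cmeasurable (fun x => f x - g x) by apply: cmeasurableB => //; exact: A_meas.
have -> : (fun x => u x * f x - u x * g x) = (fun x => u x * (f x - g x)).
  by apply/funext => x; rewrite mulrBr.
apply: (@le_trans _ _ ((Num.max 1 c)%:E * cLnorm mu p (fun x => f x - g x)%R))%E.
  apply: cLnorm_leM => //; first exact: cmeasurableM.
  by move=> x; rewrite ComplexField.Normc.normcM ler_wpM2r ?normc_ge0.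
apply: (le_trans (lee_wpmul2l _ fg)); first by rewrite lee_fin.
by rewrite -EFinM lee_fin mulrC divfK ?gt_eqF.
Qed.

Lemma Lp_closureZ (c : R[i]) f : Lp_closure f -> Lp_closure (fun x => c * f x).
Proof.
apply: (@Lp_closureM_bounded (normc c) (fun=> c)) => // g Ag.
exact/sub_Lp_closure/AZ.
Qed.

(** Dominated convergence applied to [|F k - f|^p], with majorant [|2 g|^p]. *)
Lemma Lp_closure_dominated (F : nat -> T -> R[i]) f (g : T -> R[i]) :
  (forall k, Lp_closure (F k)) -> cmeasurable f -> cLfun mu p g ->
  (forall x, normc (F k x - f x) @[k --> \oo] --> 0) ->
  (forall k x, normc (F k x) <= normc (g x)) ->
  (forall x, normc (f x) <= normc (g x)) ->
  Lp_closure f.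
Proof.
move=> FK mf /[dup] Lg /cLfunP[mg gy] Ff Fg fg.
have mF k : cmeasurable (F k) := Lp_closure_meas (FK k).
have Lf : cLfun mu p f.
  by apply: (@cLfun_le 1 f g) => // x; rewrite mul1r.
apply: Lp_closed => // e e0.
pose h k x : \bar R := (normc (F k x - f x) `^ p)%:E.
pose H x : \bar R := (normc (2 * g x) `^ p)%:E.
have mnp u : cmeasurable u -> measurable_fun setT (fun x => (normc (u x) `^ p)%:E).
  move=> cu; apply/measurable_EFinP.
  by apply: measurable_fun_powR; exact: cmeasurable_normc.
have mh k : measurable_fun setT (h k) by apply: mnp; exact: cmeasurableB.
have hH k x : (`|h k x| <= H x)%E.
  rewrite gee0_abs ?lee_fin ?powR_ge0// ge0_ler_powR ?nnegrE ?normc_ge0 ?(ltW p_gt0)//.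
  apply: le_trans (normcD_le _ _) _; rewrite normcN ComplexField.Normc.normcM.
  have -> : normc (2 : R[i]) = 2 :> R.
    by have := @normc_real R 2; rewrite rmorph_nat ger0_norm.
  by rewrite mulr_natl mulr2n lerD.
have iH : mu.-integrable setT H.
  apply/integrableP; split; first by apply: mnp; exact: cmeasurableZ.
  have /cLfunP[m2 L2] := cLfunZ 2 Lg; move: L2; rewrite cLnorm_lty// => L2.
  by under eq_integral => x _ do rewrite gee0_abs ?lee_fin ?powR_ge0//.
have h0 x : h ^~ x @ \oo --> 0%E.
  apply/fine_cvgP; split; first by apply: nearW.
  apply/cvgrPdist_lt => eps eps0.
  have eps1 : 0 < eps `^ (p^-1) by rewrite powR_gt0.
  have /cvgrPdist_lt/(_ _ eps1) := Ff x.
  apply: filterS => k; rewrite !sub0r !normrN/= ger0_norm ?normc_ge0// => Hk.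
  rewrite ger0_norm ?powR_ge0//.
  have -> : eps = (eps `^ (p^-1)) `^ p by rewrite -powRrM mulVf// powRr1// ltW.
  by rewrite gt0_ltr_powR ?nnegrE ?powR_ge0 ?normc_ge0.
have [_ _] := dominated_convergence measurableT mh (@measurable_cst _ _ _ _ _ 0%E)
  (aeW _ (fun x _ => h0 x)) iH (aeW _ (fun x k _ => hH k x)).
rewrite integral0 => /fine_cvgP[hfin /cvgrPdist_lt].
move=> /(_ _ (powR_gt0 p e0)) hsmall.
have [k [kfin ksmall]] := filter_ex (filterI hfin hsmall).
exists (F k); first exact: FK.
have -> : cLnorm mu p (fun x => f x - F k x) = cLnorm mu p (fun x => F k x - f x).
  by rewrite !cLnormE; under eq_integral do rewrite -normcN opprB.
rewrite cLnorm_le_real ?(ltW e0)//.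
have -> : (\int[mu]_x (normc (F k x - f x) `^ p)%:E =
    (fine (\int[mu]_x h k x))%:E)%E by rewrite fineK.
rewrite lee_fin.
by move: ksmall; rewrite sub0r normrN => /ltW; apply: le_trans; exact: ler_norm.
Qed.

End Closure.

End LpSeminorm.

(** * Taylor bounds for the complex exponential *)

Section Cis.
Context (R : realType).
Implicit Types (s t : R).

Definition cis s : R[i] := (cos s +i* sin s)%C.

Lemma cisD s t : cis (s + t) = cis s * cis t.
Proof.
by apply/eqP; rewrite eq_complex /= cosD sinD [cos s * sin t + _]addrC !eqxx.
Qed.

Lemma cis0 : cis 0 = 1.
Proof. by rewrite /cis cos0 sin0. Qed.

Lemma normc_cis s : normc (cis s) = 1.
Proof. by rewrite /= cos2Dsin2 sqrtr1. Qed.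

(** The parts of [i^k] encode the Taylor coefficients of [cos] and [sin] at once; the recursions
    [aS] and [bS] express that each function is, up to sign, the derivative of the other. *)
Let a k : R := complex.Re (('i%C : R[i]) ^+ k).
Let b k : R := complex.Im (('i%C : R[i]) ^+ k).

Let aS k : a k.+1 = - b k.
Proof. by rewrite /a /b exprSr ReiNIm. Qed.
Let bS k : b k.+1 = a k.
Proof. by rewrite /a /b exprSr ImiRe. Qed.

Let tcos m : {poly R} := \poly_(k < m) (a k / k`!%:R).
Let tsin m : {poly R} := \poly_(k < m) (b k / k`!%:R).

Let deriv_taylor (c : nat -> R) m :
  (\poly_(k < m.+1) (c k / k`!%:R))^`() = \poly_(k < m) (c k.+1 / k`!%:R).
Proof.
apply/polyP => k; rewrite coef_deriv !coef_poly ltnS.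
case: ifP => _; last by rewrite mul0rn.
by rewrite factS natrM -[LHS]mulr_natr invfM mulrA mulrAC divfK ?pnatr_eq0.
Qed.

(** The mean value theorem gives [f s = s * df c] with [|c| <= |s|], without the factor [1/(m+1)] of
    an integration; this is why the remainders below carry no factorial. *)
Let mvt0 (f df : R -> R) m s : f 0 = 0 -> (forall x : R, is_derive x 1 f (df x)) ->
  (forall x : R, `|df x| <= `|x| ^+ m) -> `|f s| <= `|s| ^+ m.+1.
Proof.
move=> f0 fdf dfm.
have cf : continuous f by move=> x; apply: differentiable_continuous; apply/derivable1_diffP; case: (fdf x).
have [s0|s0] := leP 0 s.
  have [|c /itvP cs] := @MVT_segment R f df 0 s s0 (fun x _ => fdf x).
    exact/continuous_subspaceT.
  rewrite f0 !subr0 => ->; rewrite normrM exprSr ler_wpM2r//.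
  apply: (le_trans (dfm c)); rewrite lerXn2r ?nnegrE//.
  by rewrite !ger0_norm ?cs.
have [|c /itvP cs] := @MVT_segment R f df s 0 (ltW s0) (fun x _ => fdf x).
  exact/continuous_subspaceT.
rewrite f0 !sub0r mulrN => /oppr_inj ->.
rewrite normrM exprSr ler_wpM2r//.
apply: (le_trans (dfm c)); rewrite lerXn2r ?nnegrE//.
by rewrite !ler0_norm ?cs ?lerN2 ?cs// ltW.
Qed.

(** Proved jointly, since the derivative of either remainder is, up to sign, the other one of lower
    order. *)
Let taylor_cos_sin m s : `|cos s - (tcos m).[s]| <= `|s| ^+ m /\
  `|sin s - (tsin m).[s]| <= `|s| ^+ m.
Proof.
elim: m s => [|m IH] s.
  by rewrite /tcos /tsin !poly_def !big_ord0 !horner0 !subr0 expr0 cos_max sin_max.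
split.
  apply: (@mvt0 (fun x => cos x - (tcos m.+1).[x])
      (fun x => - (sin x - (tsin m).[x]))) => [|x|x].
  - rewrite cos0 horner_coef0 coef_poly/= /a expr0 fact0 divr1/=.
    by rewrite subrr.
  - have -> : - (sin x - (tsin m).[x]) = - sin x - (tcos m.+1)^`().[x].
      rewrite deriv_taylor opprB addrC; congr (_ + _).
      rewrite /tsin !horner_poly -sumrN; apply: eq_bigr => k _.
      by rewrite aS !mulNr opprK.
    exact: is_deriveB.
  - by rewrite normrN; case: (IH x).
apply: (@mvt0 (fun x => sin x - (tsin m.+1).[x])
    (fun x => cos x - (tcos m).[x])) => [|x|x].
- by rewrite sin0 horner_coef0 coef_poly/= /b expr0 fact0 divr1/= subrr.
- have -> : cos x - (tcos m).[x] = cos x - (tsin m.+1)^`().[x].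
    rewrite deriv_taylor; congr (_ - _).
    by rewrite !horner_poly; apply: eq_bigr => k _; rewrite bS.
  exact: is_deriveB.
- by case: (IH x).
Qed.

Lemma taylor_cis m s :
  normc (cis s - \sum_(k < m) 'i%C ^+ k * (s ^+ k / k`!%:R)%:C%C) <= 2 * `|s| ^+ m.
Proof.
have -> : \sum_(k < m) 'i%C ^+ k * (s ^+ k / k`!%:R)%:C%C =
    ((tcos m).[s] +i* (tsin m).[s])%C.
  rewrite !horner_poly; elim: m => [|m IH]; first by rewrite !big_ord0.
  rewrite !big_ord_recr/= IH /a /b; case: ('i%C ^+ m) => u v.
  by apply/eqP; rewrite eq_complex /= !mulr0 subr0 add0r; apply/andP; split; apply/eqP;
    field; rewrite pnatr_eq0 -lt0n fact_gt0.
have [c1 s1] := taylor_cos_sin m s.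
apply: le_trans (normc_le_ReIm _) _.
by rewrite mulr_natl mulr2n lerD.
Qed.

Lemma cis_lipschitz s t : normc (cis s - cis t) <= 2 * `|s - t|.
Proof.
have -> : cis s - cis t = cis t * (cis (s - t) - 1).
  by rewrite mulrBr -cisD subrKC mulr1.
rewrite ComplexField.Normc.normcM normc_cis mul1r.
have := taylor_cis 1 (s - t).
by rewrite big_ord_recl big_ord0 addr0 expr1 !expr0 fact0 divr1 mul1r.
Qed.

End Cis.

(** * Polynomials and exponentials on R^n *)

Section Dot.
Context (R : realType) (n : nat).
Implicit Types (u v x : 'rV[R]_n) (c : R).

Lemma dotDl u v x : dot (u + v) x = dot u x + dot v x.
Proof. by rewrite /dot -big_split/=; apply: eq_bigr => i _; rewrite mxE mulrDl. Qed.

Lemma dotZl c u x : dot (c *: u) x = c * dot u x.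
Proof. by rewrite /dot mulr_sumr; apply: eq_bigr => i _; rewrite mxE mulrA. Qed.

Lemma dot0l x : dot 0 x = 0.
Proof. by rewrite /dot big1// => i _; rewrite mxE mul0r. Qed.

Lemma dotNl u x : dot (- u) x = - dot u x.
Proof. by rewrite -scaleN1r dotZl mulN1r. Qed.

Lemma dotBl u v x : dot (u - v) x = dot u x - dot v x.
Proof. by rewrite dotDl dotNl. Qed.

Lemma dot_suml (m : nat) (F : 'I_m -> 'rV[R]_n) x :
  dot (\sum_(i < m) F i) x = \sum_(i < m) dot (F i) x.
Proof.
elim: m F => [|m IH] F; first by rewrite !big_ord0 dot0l.
by rewrite !big_ord_recl dotDl IH.
Qed.

Lemma dot_delta (i : 'I_n) x : dot (delta_mx ord0 i) x = x ord0 i.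
Proof.
rewrite /dot (bigD1 i)//= mxE !eqxx mul1r big1 ?addr0// => j ji.
by rewrite mxE (negbTE ji) andbF mul0r.
Qed.

Lemma dot_ge0 x : 0 <= dot x x.
Proof. by apply: sumr_ge0 => i _; rewrite -expr2 sqr_ge0. Qed.

Lemma enorm_ge0 x : 0 <= enorm x. Proof. exact: sqrtr_ge0. Qed.

Lemma coord_le_enorm x (i : 'I_n) : `|x ord0 i| <= enorm x.
Proof.
rewrite -sqrtr_sqr ler_wsqrtr// /dot (bigD1 i)//= -expr2 lerDl.
by apply: sumr_ge0 => j _; rewrite -expr2 sqr_ge0.
Qed.

Lemma dot_le_enorm v x : `|dot v x| <= (\sum_(i < n) `|v ord0 i|) * enorm x.
Proof.
apply: le_trans (ler_norm_sum _ _ _) _; rewrite mulr_suml; apply: ler_sum => i _.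
by rewrite normrM ler_wpM2l ?coord_le_enorm.
Qed.

Lemma enorm_le_sum x : enorm x <= \sum_(i < n) `|x ord0 i|.
Proof.
rewrite -[leRHS]ger0_norm ?sumr_ge0// -sqrtr_sqr ler_wsqrtr//.
rewrite /dot expr2 mulr_suml; apply: ler_sum => i _.
apply: le_trans (ler_norm _) _; rewrite normrM ler_wpM2l//.
by rewrite (bigD1 i)//= lerDl sumr_ge0.
Qed.

End Dot.

Section PolynomialFunctions.
Context (R : realType) (n : nat).
Implicit Types (f g : 'rV[R]_n -> R[i]).

(** An induction principle on functions, not on formal polynomials, so that predicates on functions
    are reached through single multiplications by a coordinate. *)
Lemma mpoly_fun_ind (K : ('rV[R]_n -> R[i]) -> Prop) :
  (forall c, K (fun=> c)) ->
  (forall f g, K f -> K g -> K (fun x => f x + g x)) ->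
  (forall i f, K f -> K (fun x => (x ord0 i)%:C%C * f x)) ->
  forall f, polynomials f -> K f.
Proof.
move=> Kc KD KX _ [P _ <-]; elim/mpoly.mpolyind: P => [|c m P _ _ KP].
  have -> : mpoly_fun (0 : mpoly.mpoly n R[i]) = fun=> 0; last exact: Kc.
  by apply/funext => x; rewrite /mpoly_fun raddf0.
have -> : mpoly_fun (c *: mpoly.mpolyX R[i] m + P) =
    fun x => \prod_(i < n) (x ord0 i)%:C%C ^+ mpoly.fun_of_multinom m i * c
      + mpoly_fun P x.
  apply/funext => x.
  by rewrite /mpoly_fun mpoly.mevalD mpoly.mevalZ mpoly.mevalX mulrC.
apply: KD => //.
elim: (index_enum _) => [|i s IH].
  by under eq_fun do rewrite big_nil mul1r; exact: Kc.
under eq_fun do rewrite big_cons -mulrA.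
elim: (mpoly.fun_of_multinom m i) => [|k IHk].
  by under eq_fun do rewrite expr0 mul1r.
by under eq_fun do rewrite exprS -mulrA; apply: KX.
Qed.

Lemma polynomials_cst (c : R[i]) : @polynomials R n (fun=> c).
Proof.
exists (mpoly.mpolyC n c) => //.
by apply/funext => x; rewrite /mpoly_fun mpoly.mevalC.
Qed.

Lemma polynomialsD f g : polynomials f -> polynomials g ->
  polynomials (fun x => f x + g x).
Proof.
move=> [P _ <-] [Q _ <-]; exists (P + Q) => //.
by apply/funext => x; rewrite /mpoly_fun mpoly.mevalD.
Qed.

Lemma polynomialsM f g : polynomials f -> polynomials g ->
  polynomials (fun x => f x * g x).
Proof.
move=> [P _ <-] [Q _ <-]; exists (P * Q) => //.
by apply/funext => x; rewrite /mpoly_fun mpoly.mevalM.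
Qed.

Lemma polynomialsZ (c : R[i]) f : polynomials f -> polynomials (fun x => c * f x).
Proof. exact/polynomialsM/polynomials_cst. Qed.

Lemma polynomials_coord (i : 'I_n) : polynomials (fun x : 'rV[R]_n => (x ord0 i)%:C%C).
Proof.
exists (mpoly.mpolyX R[i] (mpoly.mnm1 i)) => //.
by apply/funext => x; rewrite /mpoly_fun mpoly.mevalXU.
Qed.

Lemma polynomials_dot (v : 'rV[R]_n) : polynomials (fun x => (dot v x)%:C%C).
Proof.
rewrite /dot; elim: (index_enum _) => [|i s IH].
  by under eq_fun do rewrite big_nil; exact: polynomials_cst.
under eq_fun do rewrite big_cons rmorphD rmorphM/=.
by apply: polynomialsD => //; apply/polynomialsZ/polynomials_coord.
Qed.

Lemma polynomialsX f (k : nat) : polynomials f -> polynomials (fun x => f x ^+ k).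
Proof.
move=> Pf; elim: k => [|k IH].
  by under eq_fun do rewrite expr0; exact: polynomials_cst.
by under eq_fun do rewrite exprS; apply: polynomialsM.
Qed.

Lemma polynomials_growth f : polynomials f ->
  exists C (k : nat), 0 <= C /\ forall x, normc (f x) <= C * (1 + enorm x) ^+ k.
Proof.
move=> Pf; pattern f; apply: mpoly_fun_ind Pf => [c|{}f g|i {}f].
- exists (normc c), 0%N; split; first exact: normc_ge0.
  by move=> x; rewrite expr0 mulr1.
- move=> [C [k [C0 Cf]]] [D [l [D0 Dg]]].
  exists (C + D), (k + l)%N; split; first exact: addr_ge0.
  move=> x; apply: le_trans (normcD_le _ _) _; rewrite mulrDl.
  have e1 : 1 <= 1 + enorm x by rewrite lerDl enorm_ge0.
  have e0 := le_trans ler01 e1.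
  apply: lerD.
    apply: (le_trans (Cf x)); rewrite ler_wpM2l// exprD ler_peMr ?exprn_ge0//.
    exact: exprn_ege1.
  apply: (le_trans (Dg x)); rewrite ler_wpM2l// exprD ler_peMl ?exprn_ge0//.
  exact: exprn_ege1.
move=> [C [k [C0 Cf]]]; exists C, k.+1; split=> // x.
rewrite ComplexField.Normc.normcM normc_real exprS mulrCA ler_pM ?normc_ge0//.
by apply: le_trans (coord_le_enorm _ _) _; rewrite lerDr.
Qed.

End PolynomialFunctions.

Section Measurability.
Context (R : realType) (n : nat).

Lemma measurable_coord (i : 'I_n) :
  measurable_fun setT (fun x : borelRn R n => (x : 'rV[R]_n) ord0 i).
Proof.
apply: (measurability _ (RGenOpens.measurableE R)) => _ [_ [a [b ->] <-]].
rewrite setTI; apply: sub_sigma_algebra.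
by apply: open_comp; [move=> x _; exact: coord_continuous|exact: interval_open].
Qed.

Lemma measurable_dot (v : 'rV[R]_n) :
  measurable_fun setT (fun x : borelRn R n => dot v x).
Proof.
apply: measurable_sum => i; apply: measurable_funM => //.
exact: measurable_coord.
Qed.

Lemma measurable_enorm : measurable_fun setT (fun x : borelRn R n => enorm x).
Proof.
have -> : @enorm R n = fun x => (dot x x) `^ (2^-1).
  by apply/funext => x; rewrite powR12_sqrt// dot_ge0.
apply: measurable_fun_powR; apply: measurable_sum => i.
by apply: measurable_funM; exact: measurable_coord.
Qed.

Lemma cmeasurable_polynomials (f : borelRn R n -> R[i]) :
  polynomials (f : 'rV[R]_n -> R[i]) -> cmeasurable f.
Proof.
move=> Pf; pattern f; apply: mpoly_fun_ind Pf => [c|{}f g|i {}f].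
- exact: cmeasurable_cst.
- exact: cmeasurableD.
by move=> mf; apply: cmeasurableM => //; apply: cmeasurable_real; exact: measurable_coord.
Qed.

Lemma expiE (l x : 'rV[R]_n) : expi l x = cis (dot l x). Proof. by []. Qed.

Lemma expiD (l l' x : 'rV[R]_n) : expi (l + l') x = expi l x * expi l' x.
Proof. by rewrite !expiE dotDl cisD. Qed.

Lemma expi0 (x : 'rV[R]_n) : expi 0 x = 1.
Proof. by rewrite expiE dot0l cis0. Qed.

Lemma normc_expi (l x : 'rV[R]_n) : normc (expi l x) = 1.
Proof. by rewrite expiE normc_cis. Qed.

Lemma cmeasurable_expi (l : 'rV[R]_n) : cmeasurable (fun x : borelRn R n => expi l x).
Proof.
apply: cmeasurable_complex.
- apply: (@measurableT_comp _ _ _ _ _ _ (@cos R)); last exact: measurable_dot.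
  by apply: continuous_measurable_fun; exact: continuous_cos.
- apply: (@measurableT_comp _ _ _ _ _ _ (@sin R)); last exact: measurable_dot.
  by apply: continuous_measurable_fun; exact: continuous_sin.
Qed.

End Measurability.

(** * Integrability from finite moments *)

Section Moments.
Context (R : realType) (n : nat) (mu : {measure set (borelRn R n) -> \bar R}).
Hypothesis mu_moments : finite_moments mu.

Lemma finite_moments_total : (mu setT < +oo)%E.
Proof.
have := mu_moments (lexx 0).
by under eq_integral do rewrite powRr0; rewrite integral_cst// mul1e.
Qed.

Lemma finite_moments_cLfun (p : R) (f : borelRn R n -> R[i]) : 1 <= p ->
  polynomials (f : 'rV[R]_n -> R[i]) -> cLfun mu p f.
Proof.
move=> p1 Pf; have mf := cmeasurable_polynomials Pf.
have p0 : 0 <= p := le_trans ler01 p1.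
apply/(cLfunP _ _ _); split=> //; rewrite cLnorm_lty//.
have [C [k [C0 Cf]]] := polynomials_growth Pf.
(* From [(1 + s)^(kp) <= 2^(kp) (1 + s^(kp))], obtained by comparing [s] with 1; the summand 1 is
   the moment of order 0. *)
pose B := C `^ p * 2 `^ (k%:R * p).
have B0 : 0 <= B by rewrite mulr_ge0 ?powR_ge0.
have kp0 : 0 <= k%:R * p by rewrite mulr_ge0.
have mpow (a : R) : measurable_fun setT (fun x : borelRn R n => (enorm x `^ a)%:E).
  apply/measurable_EFinP; apply: measurable_fun_powR; exact: measurable_enorm.
apply: (@le_lt_trans _ _ (\int[mu]_x (B%:E * ((enorm (x : 'rV[R]_n) `^ 0)%:E +
    (enorm (x : 'rV[R]_n) `^ (k%:R * p))%:E)))%E).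
  apply: ge0_le_integral => //.
  - by move=> x _; rewrite lee_fin powR_ge0.
  - apply/measurable_EFinP; apply: measurable_fun_powR.
    exact: cmeasurable_normc.
  - by apply: emeasurable_funM => //; apply: emeasurable_funD.
  move=> x _; rewrite -EFinD -EFinM lee_fin.
  have e0 := enorm_ge0 x; have e1 : 0 <= 1 + enorm x by rewrite addr_ge0.
  apply: (@le_trans _ _ ((C * (1 + enorm x) ^+ k) `^ p)).
    by rewrite ge0_ler_powR ?nnegrE ?normc_ge0 ?mulr_ge0 ?exprn_ge0.
  rewrite powRM ?exprn_ge0// -powR_mulrn// -powRrM -mulrA ler_wpM2l ?powR_ge0//.
  have [x1|x1] := leP (enorm x) 1.
    rewrite powRr0 mulrDr mulr1 ler_wpDr ?mulr_ge0 ?powR_ge0//.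
    by rewrite ge0_ler_powR ?nnegrE// -[leRHS]/(1 + 1) lerD2l.
  rewrite mulrDr ler_wpDl ?mulr_ge0 ?powR_ge0// -powRM//.
  rewrite ge0_ler_powR ?nnegrE ?mulr_ge0// mulr_natl mulr2n lerD2r.
  exact: ltW.
rewrite ge0_integralZl//; last 2 first.
- exact: emeasurable_funD.
- by move=> x _; rewrite adde_ge0 ?lee_fin ?powR_ge0.
rewrite ge0_integralD//; try by move=> x _; rewrite lee_fin powR_ge0.
by rewrite lte_mul_pinfty ?lee_fin// lte_add_pinfty// mu_moments.
Qed.

Lemma bounded_cLfun (p C : R) (f : borelRn R n -> R[i]) : 1 <= p -> 0 <= C ->
  cmeasurable f -> (forall x, normc (f x) <= C) -> cLfun mu p f.
Proof.
move=> p1 C0 mf fC; apply: (cLfun_le p1 mf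
  (finite_moments_cLfun p1 (@polynomials_cst R n 1)) C0) => x.
by rewrite ComplexField.Normc.normc1 mulr1.
Qed.

Lemma polynomials_expi_cLfun (p : R) (f : borelRn R n -> R[i]) (l : 'rV[R]_n) :
  1 <= p -> polynomials (f : 'rV[R]_n -> R[i]) ->
  cLfun mu p (fun x => f x * expi l x).
Proof.
move=> p1 Pf; apply: (cLfun_le p1 _ (finite_moments_cLfun p1 Pf) ler01) => [|x].
  by apply: cmeasurableM; [exact: cmeasurable_polynomials|exact: cmeasurable_expi].
by rewrite ComplexField.Normc.normcM normc_expi mulr1 mul1r.
Qed.

End Moments.

(** * Exponentials are limits of polynomials *)

Section Density.
Context (R : realType) (n : nat) (mu : {measure set (borelRn R n) -> \bar R}).
Context (p : R).
Hypothesis p_ge1 : 1 <= p.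
Hypothesis mu_moments : finite_moments mu.

Let p_gt0 : 0 < p. Proof. exact: lt_le_trans p_ge1. Qed.
Let p_ge0 : 0 <= p. Proof. exact: ltW. Qed.

Local Notation pol := (@polynomials R n : set (borelRn R n -> R[i])).
Local Notation K := (Lp_closure mu p pol).

Let pol_Lp : pol `<=` cLfun mu p.
Proof. by move=> f; exact: finite_moments_cLfun. Qed.

Let pol0 : pol (fun=> 0). Proof. exact: polynomials_cst. Qed.
Let polD f g : pol f -> pol g -> pol (fun x => f x + g x).
Proof. exact: polynomialsD. Qed.
Let polZ c f : pol f -> pol (fun x => c * f x).
Proof. exact: polynomialsZ. Qed.

(* Only even powers of [dot v x] occur, so that the hypothesis passes from a
   measure to any other one with the same moments. *)
Lemma polynomial_power_bound (v : 'rV[R]_n) (r : nat) (M : nat -> R) (B : R) :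
  p <= r%:R -> (forall j, 0 < M j) -> 0 <= B ->
  (forall j, (\int[mu]_x ((dot v (x : 'rV[R]_n)) ^+ (2 * r * j))%:E <=
     (B * M j ^+ (2 * r))%:E)%E) ->
  forall P, pol P -> exists2 C, 0 < C & forall j,
    (cLnorm mu p (fun x : borelRn R n => P x * (dot v x ^+ j)%:C%C)%R <= (C * M j)%:E)%E.
Proof.
move=> pr M0 B0 HB P PP.
have mP := cmeasurable_polynomials PP.
have PP2 : pol (fun x => P x * P x) by exact: polynomialsM.
have mP2 := cmeasurable_polynomials PP2.
pose I1 := (\int[mu]_x (normc (P x) `^ p)%:E)%E.
pose I2 := (\int[mu]_x (normc (P x * P x) `^ p)%:E)%E.
have I10 : (0 <= I1)%E by apply: integral_ge0 => x _; rewrite lee_fin powR_ge0.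
have I20 : (0 <= I2)%E by apply: integral_ge0 => x _; rewrite lee_fin powR_ge0.
have I1y : (I1 < +oo)%E by rewrite -cLnorm_lty//; case/(cLfunP _ _ _): (pol_Lp PP).
have I2y : (I2 < +oo)%E by rewrite -cLnorm_lty//; case/(cLfunP _ _ _): (pol_Lp PP2).
pose D := fine I1 + fine I2 + B + 1.
have D0 : 0 < D by rewrite ltr_wpDl ?addr_ge0 ?fine_ge0.
have DE : (I1 + I2 + (B + 1)%:E)%E = D%:E.
  by rewrite -[I1]fineK ?ge0_fin_numE// -[I2]fineK ?ge0_fin_numE// -!EFinD addrA.
exists (D `^ (p^-1)); first by rewrite powR_gt0.
move=> j; have mj : cmeasurable (fun x : borelRn R n => P x * (dot v x ^+ j)%:C%C).
  apply: cmeasurableM => //; apply: cmeasurable_real.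
  by apply: measurable_funX; exact: measurable_dot.
rewrite cLnorm_le_real ?mulr_ge0 ?powR_ge0 ?(ltW (M0 j))//.
rewrite powRM ?powR_ge0 ?(ltW (M0 j))// -powRrM mulVf ?gt_eqF// powRr1 ?(ltW D0)//.
have mpowP u : cmeasurable u -> measurable_fun setT (fun x : borelRn R n => (normc (u x) `^ p)%:E).
  by move=> mu'; apply/measurable_EFinP; apply: measurable_fun_powR; exact: cmeasurable_normc.
have mdot k : measurable_fun setT (fun x : borelRn R n => (dot v x ^+ k)%:E).
  by apply/measurable_EFinP; apply: measurable_funX; exact: measurable_dot.
have even0 (x : 'rV[R]_n) : 0 <= dot v x ^+ (2 * r * j).
  by rewrite -mulnA exprM exprn_ge0// sqr_ge0.
have cE0 : (0 <= ((M j ^+ (2 * r))^-1)%:E :> \bar R)%E.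
  by rewrite lee_fin invr_ge0 exprn_ge0// ltW.
apply: (@le_trans _ _ (\int[mu]_x ((M j `^ p)%:E * ((normc (P x) `^ p)%:E
   + (normc (P x * P x) `^ p)%:E
   + ((M j ^+ (2 * r))^-1)%:E * (dot v (x : 'rV[R]_n) ^+ (2 * r * j))%:E)))%E).
  apply: ge0_le_integral => //.
  - by move=> x _; rewrite lee_fin powR_ge0.
  - exact: mpowP.
  - apply: emeasurable_funM => //; apply: emeasurable_funD; last exact: emeasurable_funM.
    by apply: emeasurable_funD; exact: mpowP.
  move=> x _; rewrite [leRHS](_ : _ = (M j `^ p * (normc (P x) `^ p +
    normc (P x * P x) `^ p + (M j ^+ (2 * r))^-1 * dot v x ^+ (2 * r * j)))%:E)// lee_fin.
  rewrite !ComplexField.Normc.normcM normc_real normrX !powRM ?normc_ge0 ?exprn_ge0//.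
  set a := normc (P x) `^ p; have a0 : 0 <= a by exact: powR_ge0.
  (* With [a = |P|^p], the bound is [a z^p <= a (1 + z^r) <= a + a^2 + z^(2r)]. Here [a^2] is the
     [p]-th power of [|P * P|], and the integral of [z^(2r)] is at most [B] by hypothesis, uniformly
     in [j]. *)
  pose z := `|dot v x| ^+ j / M j.
  have z0 : 0 <= z by rewrite divr_ge0 ?exprn_ge0 ?(ltW (M0 j)).
  have -> : `|dot v x| ^+ j = M j * z by rewrite /z mulrC divfK// gt_eqF.
  have -> : (M j ^+ (2 * r))^-1 * dot v x ^+ (2 * r * j) = (z ^+ r) ^+ 2.
    rewrite -exprM [(r * 2)%N]mulnC /z expr_div_n mulrC; congr (_ / _).
    by rewrite -[LHS]ger0_norm// normrX -exprM [(j * _)%N]mulnC.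
  rewrite powRM ?(ltW (M0 j))// mulrCA ler_wpM2l ?powR_ge0//.
  have zp : z `^ p <= 1 + z ^+ r.
    have [z1|z1] := leP z 1.
      rewrite ler_wpDr ?exprn_ge0//.
      apply: (@le_trans _ _ (1 `^ p)); last by rewrite powR1.
      by rewrite ge0_ler_powR ?nnegrE.
    by rewrite ler_wpDl// -powR_mulrn// ler_powR// ltW.
  apply: (@le_trans _ _ (a * (1 + z ^+ r))); first by rewrite ler_wpM2l.
  rewrite mulrDr mulr1 -addrA lerD2l.
  have := sqr_ge0 (a - z ^+ r); have : 0 <= a * z ^+ r by rewrite mulr_ge0 ?exprn_ge0.
  by move: (z ^+ r) => s; rewrite sqrrB mulr2n expr2; lra.
rewrite ge0_integralZl//; last 3 first.
- apply: emeasurable_funD; last exact: emeasurable_funM.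
  by apply: emeasurable_funD; exact: mpowP.
- by move=> x _; rewrite !adde_ge0 ?mule_ge0 ?lee_fin ?powR_ge0.
- by rewrite lee_fin powR_ge0.
rewrite muleC [leRHS]EFinM lee_wpmul2r ?lee_fin ?powR_ge0//.
rewrite ge0_integralD//; last 4 first.
- by move=> x _; rewrite adde_ge0 ?lee_fin ?powR_ge0.
- by apply: emeasurable_funD; exact: mpowP.
- by move=> x _; rewrite mule_ge0// lee_fin.
- exact: emeasurable_funM.
rewrite ge0_integralD//; try by [move=> x _; rewrite lee_fin powR_ge0|exact: mpowP].
rewrite ge0_integralZl//; last by move=> x _; rewrite lee_fin.
rewrite -DE leeD2l//.
apply: (@le_trans _ _ B%:E); last by rewrite lee_fin lerDl.
apply: le_trans (lee_wpmul2l _ (HB j)) _ => //.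
by rewrite -EFinM lee_fin mulrC mulfK// gt_eqF// exprn_gt0.
Qed.

(** All [P] are taken together because differentiating along a direction [v] multiplies [P] by
    powers of [dot v x]. *)
Definition expi_stable (l : 'rV[R]_n) :=
  forall P, pol P -> K (fun x => P x * expi l x).

Section Direction.
Variables (v : 'rV[R]_n) (M : nat -> R).
Hypothesis M_gt0 : forall k, 0 < M k.
Hypothesis M_logconvex : forall k, M k.+1 ^+ 2 <= M k * M k.+2.
Hypothesis M_div :
  forall B, exists N : nat, B <= \sum_(k < N) M k / M k.+1.
Hypothesis M_bound : forall P, pol P -> exists2 C, 0 < C & forall j,
  (cLnorm mu p (fun x : borelRn R n => P x * (dot v x ^+ j)%:C%C)%R <= (C * M j)%:E)%E.

Lemma expi_stable_direction (l : 'rV[R]_n) (t : R) : 0 <= t ->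
  expi_stable l -> expi_stable (l + t *: v).
Proof.
move=> t0 Kl P PP; split; first exact: polynomials_expi_cLfun.
move=> e e0; have [C C0 HC] := M_bound PP.
pose f j s (x : borelRn R n) := P x * (dot v x ^+ j)%:C%C * expi (l + s *: v) x.
have PPj j : pol (fun x : borelRn R n => P x * (dot v x ^+ j)%:C%C).
  apply: polynomialsM => //; under eq_fun do rewrite rmorphXn/=.
  exact/polynomialsX/polynomials_dot.
have mf j s : cmeasurable (f j s).
  by apply: cmeasurableM; [exact: cmeasurable_polynomials|exact: cmeasurable_expi].
(* The scale [2 * C] absorbs the 2 of the Taylor remainder and the constant [C] of [M_bound], so
   that the remainder becomes exactly [h^m * M (j + m)]. *)
pose A j s d := Lp_within mu p pol (2 * C * d) (f j s).
have C20 : 0 < 2 * C by rewrite mulr_gt0.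
suff : A 0%N t (e / (2 * C)).
  rewrite /A mulrC divfK ?gt_eqF//.
  by congr (Lp_within _ _ _ _ _); apply/funext => x; rewrite /f expr0 mulr1.
apply: (@bang R M A) => // [j s d d' dd' | j d d0 | j m s h d s0 h0 Hd | ].
- by apply: Lp_within_mono; rewrite ler_wpM2l// ltW.
- have [_] := Kl _ (PPj j); rewrite /A /f scale0r addr0; apply.
  by rewrite mulr_gt0.
(* Nonnegativity of [d i] is what permits replacing [1/i!] by 1 at the end. *)
- have d0 i : (i < m)%N -> 0 <= d i.
    move=> im; have [g _ Hg] := Hd i im.
    by have := le_trans (cLnorm_ge0 _ _ _) Hg; rewrite lee_fin pmulr_rge0.
  (* The sum is the Taylor polynomial of [f j] at time [s], the [k]-th derivative of [f j] in time
     being [i^k] times [f (j + k)]. *)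
  have := @Lp_within_sum _ _ _ mu _ p_ge1 pol pol0 polD polZ pol_Lp m
    (fun i => 'i%C ^+ i * (h ^+ i / i`!%:R)%:C%C) (fun i => f (j + i)%N s)
    (fun i => 2 * C * d i) (fun i => mf _ _) (fun i => Hd i (ltn_ord i)).
  set g := (fun x : borelRn R n => \sum_(i < m) _) => Hg.
  have mg : cmeasurable g by apply: cmeasurable_sum => i; apply: cmeasurableZ.
  have fg : (cLnorm mu p (fun x => f j (s + h) x - g x)%R <=
      (2 * h ^+ m * (C * M (j + m)%N))%:E)%E.
    have h20 : 0 <= 2 * h ^+ m by rewrite mulr_ge0 ?exprn_ge0.
    rewrite EFinM; apply: le_trans (lee_wpmul2l _ (HC _)); last by rewrite lee_fin.
    apply: cLnorm_leM => //; [exact: cmeasurableB|exact: cmeasurable_polynomials|].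
    move=> x; rewrite !ComplexField.Normc.normcM normc_real.
    have -> : f j (s + h) x - g x = P x * (dot v x ^+ j)%:C%C * expi (l + s *: v) x *
        (cis (h * dot v x) -
         \sum_(i < m) 'i%C ^+ i * ((h * dot v x) ^+ i / i`!%:R)%:C%C).
      have -> : f j (s + h) x =
          P x * (dot v x ^+ j)%:C%C * expi (l + s *: v) x * cis (h * dot v x).
        by rewrite /f scalerDl addrA (expiD (l + s *: v)) [expi (h *: v) x]expiE dotZl mulrA.
      rewrite mulrBr; congr (_ - _); rewrite /g mulr_sumr; apply: eq_bigr => i _.
      rewrite /f exprD exprMn !rmorphM/=; ring.
    rewrite !ComplexField.Normc.normcM normc_expi normc_real mulr1.
    apply: le_trans (ler_wpM2l _ (taylor_cis m (h * dot v x))) _.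
      by rewrite mulr_ge0 ?normc_ge0.
    rewrite !normrX normrM exprMn exprD (ger0_norm h0) le_eqVlt.
    by apply/orP; left; apply/eqP; ring.
  have := Lp_within_near p_ge1 pol_Lp (mf _ _) mg fg Hg.
  apply: Lp_within_mono; rewrite addrC mulrDr; apply: lerD; last first.
    by rewrite le_eqVlt; apply/orP; left; apply/eqP; ring.
  rewrite mulr_sumr; apply: ler_sum => i _.
  rewrite mulrCA ler_wpM2l ?(ltW C20)// ler_wpM2r ?d0//.
  rewrite ComplexField.Normc.normcM normc_real.
  have -> : normc ('i%C ^+ i : R[i]) = 1.
    elim: (nat_of_ord i) => [|k IH]; first by rewrite expr0 ComplexField.Normc.normc1.
    rewrite exprS ComplexField.Normc.normcM IH mulr1 /=.
    by rewrite expr0n expr1n add0r sqrtr1.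
  rewrite mul1r ger0_norm ?divr_ge0 ?exprn_ge0//.
  by rewrite ler_pdivrMr ?ltr0n ?fact_gt0// ler_peMr ?exprn_ge0// ler1n fact_gt0.
by rewrite divr_gt0.
Qed.

End Direction.

Definition expi_direction (v : 'rV[R]_n) :=
  forall (l : 'rV[R]_n) (t : R), expi_stable l -> expi_stable (l + t *: v).

Lemma expi_directionP (v : 'rV[R]_n) (M : nat -> R) :
  (forall k, 0 < M k) -> (forall k, M k.+1 ^+ 2 <= M k * M k.+2) ->
  (forall B, exists N : nat, B <= \sum_(k < N) M k / M k.+1) ->
  (forall P, pol P -> exists2 C, 0 < C & forall j,
  (cLnorm mu p (fun x : borelRn R n => P x * (dot v x ^+ j)%:C%C)%R <= (C * M j)%:E)%E) ->
  expi_direction v.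
Proof.
move=> M0 Mlog Mdiv Mb l t Kl.
have [t0|t0] := leP 0 t; first exact: (@expi_stable_direction v M).
(* Negative times are positive times along [- v], for which the norms in the bound are the same. *)
rewrite -[t]opprK scaleNr -scalerN.
apply: (@expi_stable_direction (- v) M) => // [P PP|]; last by rewrite oppr_ge0 ltW.
have [C C0 HC] := Mb P PP; exists C => // j; apply: le_trans (HC j).
have mP u : cmeasurable (fun x : borelRn R n => P x * (dot u x ^+ j)%:C%C).
  apply: cmeasurableM; first exact: cmeasurable_polynomials.
  by apply: cmeasurable_real; by apply: measurable_funX; exact: measurable_dot.
apply: cLnorm_le => // x.
by rewrite !ComplexField.Normc.normcM !normc_real !normrX dotNl normrN.
Qed.

Lemma expi_stable_all (v : n.-tuple 'rV[R]_n) : basis_of fullv v ->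
  (forall j, expi_direction (tnth v j)) -> forall l, expi_stable l.
Proof.
move=> bv Hv l; rewrite (coord_basis bv (memvf l)).
elim: (index_enum _) => [|i s IH].
  rewrite big_nil => P PP; under eq_fun do rewrite expi0 mulr1.
  exact: sub_Lp_closure.
by rewrite big_cons addrC -tnth_nth; apply: Hv.
Qed.

End Density.

(** * From exponentials to all of L_p *)

Section SignIteration.
Context (R : realType).
Implicit Types (s : R).

(* The sign function is the pointwise limit on [-1, 1] of the iterates of this
   polynomial, which fixes [-1], [0] and [1]. *)
Definition sgn_step s : R := (3 * s - s ^+ 3) / 2.

Lemma sgn_stepN s : sgn_step (- s) = - sgn_step s.
Proof. by rewrite /sgn_step; field. Qed.

Lemma iter_sgn_stepN k s : iter k sgn_step (- s) = - iter k sgn_step s.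
Proof. by elim: k => //= k ->; rewrite sgn_stepN. Qed.

Lemma iter_sgn_step_bound k s : 0 < s -> s <= 1 ->
  s <= iter k sgn_step s <= 1 /\ 1 - iter k sgn_step s <= (1 - s / 2) ^+ k.
Proof.
move=> s0 s1; elim: k => [|k [/andP[sy y1] IH]] /=.
  by rewrite lexx s1 expr0; split=> //; lra.
set y := iter k _ _ in sy y1 IH *; have y0 : 0 < y := lt_le_trans s0 sy.
(* The polynomial [1 - sgn_step y] has a double root at 1, so one step multiplies the distance to 1
   by [(1 - y) (1 + y / 2) <= 1 - y / 2 <= 1 - s / 2]. *)
have E : 1 - sgn_step y = (1 - y) * ((1 - y) * (1 + y / 2)).
  by rewrite /sgn_step; field.
have y1' : 0 <= 1 - y by rewrite subr_ge0.
have b1 : (1 - y) * (1 + y / 2) <= 1 - s / 2 by nra.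
have b0 : 0 <= (1 - y) * (1 + y / 2) by rewrite mulr_ge0// addr_ge0// divr_ge0// ltW.
split.
  apply/andP; split; last by rewrite -subr_ge0 E mulr_ge0.
  have -> : sgn_step y = 1 - (1 - y) * ((1 - y) * (1 + y / 2)) by rewrite -E; ring.
  have : (1 - y) * ((1 - y) * (1 + y / 2)) <= 1 - y.
    by rewrite ler_piMr// (le_trans b1)// gerBl divr_ge0// ltW.
  by move: sy; lra.
by rewrite E exprSr ler_pM.
Qed.

Lemma iter_sgn_step_norm k s : `|s| <= 1 -> `|iter k sgn_step s| <= 1.
Proof.
move=> s1; have H t : 0 < t -> t <= 1 -> `|iter k sgn_step t| <= 1.
  move=> t0 t1; have [/andP[+ H] _] := iter_sgn_step_bound k t0 t1.
  by move=> tt; rewrite ger0_norm// (le_trans (ltW t0)).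
have [s0|s0|->] := ltgtP s 0.
- by rewrite -[s]opprK iter_sgn_stepN normrN H ?oppr_gt0// -ler0_norm// ltW.
- by rewrite H// -[s]ger0_norm// ltW.
elim: (k) => [|j IH] /=; first by rewrite normr0.
have -> : iter j sgn_step 0 = 0.
  by elim: j {IH} => //= j ->; rewrite /sgn_step mulr0 expr0n subr0 mul0r.
by rewrite /sgn_step mulr0 expr0n subr0 mul0r normr0.
Qed.

Lemma iter_sgn_step_cvg s : `|s| <= 1 ->
  (iter k sgn_step s @[k --> \oo]) --> Num.sg s.
Proof.
have H t : 0 < t -> t <= 1 -> (iter k sgn_step t @[k --> \oo]) --> (1 : R).
  move=> t0 t1.
  have : (1 - (1 - t / 2) ^+ k) @[k --> \oo] --> (1 : R).
    rewrite -[X in _ --> X]subr0; apply: cvgB; first exact: cvg_cst.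
    by apply: cvg_expr; rewrite ltr_norml; apply/andP; split; lra.
  move=> Hc; apply: squeeze_cvgr Hc (@cvg_cst _ (1 : R) _ _ _).
  apply: nearW => k; have [/andP[_ k1] k2] := iter_sgn_step_bound k t0 t1.
  by rewrite k1 andbT; lra.
move=> s1; have [s0|s0|->] := ltgtP s 0.
- rewrite ltr0_sg//; have -> : (fun k => iter k sgn_step s) = (fun k => - iter k sgn_step (- s)).
    by apply/funext => k; rewrite iter_sgn_stepN opprK.
  apply: cvgN; apply: H; first by rewrite oppr_gt0.
  by rewrite -ler0_norm// ltW.
- by rewrite gtr0_sg//; apply: H; rewrite // -[s]ger0_norm// ltW.
rewrite sgr0; have -> : (fun k => iter k sgn_step 0) = (fun=> 0).
  by apply/funext; elim=> //= k ->; rewrite /sgn_step mulr0 expr0n subr0 mul0r.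
exact: cvg_cst.
Qed.

(** For large [k] the argument lies strictly between [-pi] and [pi], where [sin] has the sign of its
    argument. Dilation thus removes the periodicity. *)
Lemma sg_sin_cvg (d : R) :
  (Num.sg (sin (d / k.+1%:R)) @[k --> \oo]) --> Num.sg d.
Proof.
have H t : 0 < t -> (Num.sg (sin (t / k.+1%:R)) @[k --> \oo]) --> (1 : R).
  move=> t0; apply: cvg_near_cst.
  exists (Num.bound (t / pi)) => // k /= kb.
  apply: gtr0_sg; apply: sin_gt0_pi; rewrite divr_gt0//= ltr_pdivrMr//.
  rewrite mulrC -ltr_pdivrMr ?pi_gt0//.
  apply: (lt_le_trans (archi_boundP _)); first by rewrite divr_ge0 ?pi_ge0 ?ltW.
  by rewrite ler_nat (leq_trans kb).
have [d0|d0|->] := ltgtP d 0; last 2 first.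
- by rewrite gtr0_sg//; exact: H.
- by under eq_fun do rewrite mul0r sin0; exact: cvg_cst.
rewrite ltr0_sg//; have -> : (fun k => Num.sg (sin (d / k.+1%:R))) =
    (fun k => - Num.sg (sin (- d / k.+1%:R))).
  by apply/funext => k; rewrite mulNr sinN sgrN opprK.
by apply: cvgN; apply: H; rewrite oppr_gt0.
Qed.

End SignIteration.

(** Boxes with rational centres and radii [1/(m+1)], enumerated by [pickle]; the flag [b k] retains
    those contained in [U]. The coordinatewise form presents each box as a finite intersection of
    half-spaces. *)
Lemma open_rV_bigcup_boxes (R : realType) (n : nat) (U : set 'rV[R]_n) : open U ->
  exists (q : nat -> 'rV[R]_n) (r : nat -> R) (b : nat -> bool),
    U = \bigcup_k (if b k then
      [set x | forall i, r k > `|q k ord0 i - x ord0 i| ] else set0).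
Proof.
move=> oU; pose qr k : 'rV[R]_n * R :=
  if (unpickle k : option ('rV[rat]_n * nat)) is Some (q, m)
  then (map_mx ratr q, m.+1%:R^-1) else (0, 0).
pose box k := [set x : 'rV[R]_n | forall i, `|(qr k).1 ord0 i - x ord0 i| < (qr k).2].
exists (fun k => (qr k).1), (fun k => (qr k).2), (fun k => `[< box k `<=` U >]).
apply/seteqP; split => [x Ux|x [k _]]; last first.
  by case: ifPn => // /asboolP; apply.
have /nbhs_ballP[e /= e0 eU] : nbhs x U by exact: open_nbhs_nbhs.
(* With a radius below [e / 2], a box containing [x] stays within distance [e] of [x], by the
   triangle inequality through its centre. *)
have [m me] : exists m : nat, m.+1%:R^-1 < e / 2.
  exists (Num.bound (2 / e)); rewrite invf_plt ?posrE ?divr_gt0//.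
  rewrite invf_div; apply: (lt_trans (archi_boundP _)); first by rewrite divr_ge0// ltW.
  by rewrite ltr_nat.
have /choice[q Hq] : forall i, exists q : rat, `|ratr q - x ord0 i| < m.+1%:R^-1.
  move=> i; have : 0 < m.+1%:R^-1 :> R by rewrite invr_gt0.
  move: (m.+1%:R^-1) => c c0.
  have /rat_in_itvoo[q] : x ord0 i - c < x ord0 i + c by lra.
  rewrite in_itv/= => /andP[q1 q2]; exists q.
  by rewrite ltr_norml; apply/andP; split; lra.
pose k := pickle ((\row_i q i : 'rV[rat]_n), m).
have qrk : qr k = (map_mx ratr (\row_i q i), m.+1%:R^-1) by rewrite /qr pickleK.
exists k => //; case: ifPn => [_|/asboolPn]; first by move=> i /=; rewrite qrk/= !mxE.
case=> y yk; apply: eU; split=> // i j.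
rewrite (ord1 i) /ball/=; have /= := yk j; rewrite qrk/= !mxE => yj.
have := Hq j; rewrite distrC => xj.
move: xj yj me; move: (m.+1%:R^-1) => c xj yj me.
apply: (le_lt_trans (ler_distD (ratr (q j)) _ _)).
apply: (lt_le_trans (ltrD xj yj)); move: me; lra.
Qed.

Import HBNNSimple.

(** * The algebra of bounded multipliers of the closure *)

Section Multipliers.
Context (R : realType) (n : nat) (mu : {measure set (borelRn R n) -> \bar R}).
Context (p : R).
Hypothesis p_ge1 : 1 <= p.
Hypothesis mu_moments : finite_moments mu.
Local Notation T := (borelRn R n).
Local Notation pol := (@polynomials R n : set (T -> R[i])).
Local Notation K := (Lp_closure mu p pol).
Hypothesis stable : forall l, expi_stable mu p l.
Implicit Types (u : T -> R).

Let pol_Lp : pol `<=` cLfun mu p.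
Proof. by move=> f; exact: finite_moments_cLfun. Qed.

Let pol0 : pol (fun=> 0). Proof. exact: polynomials_cst. Qed.
Let polD f g : pol f -> pol g -> pol (fun x => f x + g x).
Proof. exact: polynomialsD. Qed.
Let polZ c f : pol f -> pol (fun x => c * f x).
Proof. exact: polynomialsZ. Qed.

Let KD f g : K f -> K g -> K (fun x => f x + g x).
Proof. exact: Lp_closureD. Qed.
Let KZ c f : K f -> K (fun x => c * f x).
Proof. exact: Lp_closureZ. Qed.
Let polK f : pol f -> K f.
Proof. exact: sub_Lp_closure. Qed.

(** Acting on the closure [K] instead of on polynomials makes products immediate, as compositions;
    [multiplierP] shows that polynomials suffice as test functions. *)
Definition multiplier u := [/\ measurable_fun setT u,
  exists C, forall x, `|u x| <= C &
  forall f, K f -> K (fun x => (u x)%:C%C * f x)].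

Lemma multiplierP u (C : R) : measurable_fun setT u -> (forall x, `|u x| <= C) ->
  (forall f, pol f -> K (fun x => (u x)%:C%C * f x)) -> multiplier u.
Proof.
move=> mu' uC uK; split=> //; first by exists C.
move=> f Kf; apply: (Lp_closureM_bounded p_ge1 pol_Lp (c := C) (u := fun x => (u x)%:C%C)) Kf => //.
by move=> x; rewrite normc_real.
Qed.

Lemma multiplier_cst (c : R) : multiplier (fun=> c).
Proof.
split=> [||f]; [exact: measurable_cst| |exact: KZ]; by exists `|c|.
Qed.

Lemma multiplierD u v : multiplier u -> multiplier v -> multiplier (fun x => u x + v x).
Proof.
move=> [mu' [C uC] uK] [mv [D vD] vK]; split; first exact: measurable_funD.
  by exists (C + D) => x; apply: (le_trans (ler_normD _ _)); rewrite lerD.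
move=> f Kf; under eq_fun do rewrite rmorphD mulrDl.
by apply: KD; [exact: uK|exact: vK].
Qed.

Lemma multiplierM u v : multiplier u -> multiplier v -> multiplier (fun x => u x * v x).
Proof.
move=> [mu' [C uC] uK] [mv [D vD] vK]; split; first exact: measurable_funM.
  by exists (C * D) => x; rewrite normrM ler_pM.
move=> f Kf; under eq_fun do rewrite rmorphM -mulrA.
by apply: uK; exact: vK.
Qed.

Lemma multiplierZ (c : R) u : multiplier u -> multiplier (fun x => c * u x).
Proof. exact/multiplierM/multiplier_cst. Qed.

Lemma multiplierX u k : multiplier u -> multiplier (fun x => u x ^+ k).
Proof.
move=> Hu; elim: k => [|k IH].
  by under eq_fun do rewrite expr0; exact: multiplier_cst.
by under eq_fun do rewrite exprS; apply: multiplierM.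
Qed.

Lemma multiplierB u v : multiplier u -> multiplier v -> multiplier (fun x => u x - v x).
Proof.
move=> Hu Hv; have := multiplierD Hu (multiplierZ (-1) Hv).
by under eq_fun do rewrite mulN1r.
Qed.

Lemma multiplier_sum (m : nat) (F : 'I_m -> T -> R) :
  (forall i, multiplier (F i)) -> multiplier (fun x => \sum_(i < m) F i x).
Proof.
elim: m F => [|m IH] F HF.
  by under eq_fun do rewrite big_ord0; exact: multiplier_cst.
under eq_fun do rewrite big_ord_recl.
by apply: multiplierD => //; apply: (IH (fun i => F (lift ord0 i))).
Qed.

Lemma multiplier_prod (I : Type) (s : seq I) (F : I -> T -> R) :
  (forall i, multiplier (F i)) -> multiplier (fun x => \prod_(i <- s) F i x).
Proof.
move=> HF; elim: s => [|i s IH].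
  by under eq_fun do rewrite big_nil; exact: multiplier_cst.
by under eq_fun do rewrite big_cons; apply: multiplierM.
Qed.

Lemma multiplier_lim (u_ : nat -> T -> R) u (C : R) :
  (forall k, multiplier (u_ k)) -> (forall k x, `|u_ k x| <= C) ->
  (forall x, u_ k x @[k --> \oo] --> u x) -> multiplier u.
Proof.
move=> Hu uC ucvg.
have mu' : measurable_fun setT u.
  apply: (measurable_fun_cvg (h := u_)) => [k|x _]; last exact: ucvg.
  by case: (Hu k).
have uC' x : `|u x| <= C.
  have : `|u_ k x| @[k --> \oo] --> `|u x| by apply: cvg_norm; exact: ucvg.
  by move=> H; apply: (cvgr_to_le H); apply: nearW.
apply: (multiplierP mu' uC') => f Pf.
have C0 (x : T) : 0 <= C by apply: le_trans (uC' x).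
have mf := cmeasurable_polynomials Pf.
apply: (Lp_closure_dominated p_ge1 pol_Lp (F := fun k x => (u_ k x)%:C%C * f x)
   (g := fun x => C%:C%C * f x)).
- by move=> k; have [_ _] := Hu k; apply; exact: polK.
- by apply: cmeasurableM => //; exact: cmeasurable_real.
- by apply: cLfunZ => //; exact: pol_Lp.
- move=> x; have : `|u_ k x - u x| * normc (f x) @[k --> \oo] -->
      `|u x - u x| * normc (f x).
    apply: cvgM; last exact: cvg_cst.
    by apply: cvg_norm; apply: cvgB; [exact: ucvg|exact: cvg_cst].
  rewrite subrr normr0 mul0r.
  have -> // : (fun k => `|u_ k x - u x| * normc (f x)) =
      (fun k => normc ((u_ k x)%:C%C * f x - (u x)%:C%C * f x)).
    apply/funext => k.
    by rewrite -mulrBl -rmorphB ComplexField.Normc.normcM normc_real.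
- move=> k x; rewrite !ComplexField.Normc.normcM !normc_real ler_wpM2r ?normc_ge0//.
  by rewrite (ger0_norm (C0 x)).
move=> x; rewrite !ComplexField.Normc.normcM !normc_real ler_wpM2r ?normc_ge0//.
by rewrite (ger0_norm (C0 x)).
Qed.

Lemma multiplier_cos_sin (l : 'rV[R]_n) :
  multiplier (fun x : T => cos (dot l x)) /\ multiplier (fun x : T => sin (dot l x)).
Proof.
have expiN (x : 'rV[R]_n) : expi (- l) x = (cos (dot l x) -i* sin (dot l x))%C.
  by rewrite /expi dotNl cosN sinN.
split.
  apply: (@multiplierP _ 1) => [|x|f Pf]; [|exact: cos_max|].
    apply: (@measurableT_comp _ _ _ _ _ _ (@cos R)); last exact: measurable_dot.
    by apply: continuous_measurable_fun; exact: continuous_cos.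
  have := KD (KZ (2^-1)%:C%C (stable l Pf)) (KZ (2^-1)%:C%C (stable (- l) Pf)).
  congr (Lp_closure _ _ _ _); apply/funext => x.
  rewrite expiN /expi -!mulrDr mulrCA [RHS]mulrC; congr (_ * _).
  by apply/eqP; rewrite eq_complex /=; apply/andP; split; apply/eqP; field.
apply: (@multiplierP _ 1) => [|x|f Pf]; [|exact: sin_max|].
  apply: (@measurableT_comp _ _ _ _ _ _ (@sin R)); last exact: measurable_dot.
  by apply: continuous_measurable_fun; exact: continuous_sin.
have := KD (KZ (0 -i* (2^-1))%C (stable l Pf)) (KZ (0 +i* (2^-1))%C (stable (- l) Pf)).
congr (Lp_closure _ _ _ _); apply/funext => x.
rewrite expiN /expi mulrCA [X in _ + X]mulrCA -mulrDr [RHS]mulrC; congr (_ * _).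
by apply/eqP; rewrite eq_complex /=; apply/andP; split; apply/eqP; field.
Qed.

Lemma multiplier_sg u : multiplier u -> (forall x, `|u x| <= 1) ->
  multiplier (fun x => Num.sg (u x)).
Proof.
move=> Hu u1; apply: (@multiplier_lim (fun k x => iter k (@sgn_step R) (u x)) _ 1).
- elim=> [//|k IH]; rewrite /= /sgn_step.
  under eq_fun do rewrite mulrC.
  by apply/multiplierZ/multiplierB; [exact: multiplierZ|exact: multiplierX].
- by move=> k x; apply: iter_sgn_step_norm.
- by move=> x; apply: iter_sgn_step_cvg.
Qed.

Lemma multiplier_sg_coord (i : 'I_n) (a : R) :
  multiplier (fun x : T => Num.sg ((x : 'rV[R]_n) ord0 i - a)).
Proof.
apply: (@multiplier_lim (fun k (x : T) =>
  Num.sg (sin (((x : 'rV[R]_n) ord0 i - a) / k.+1%:R))) _ 1).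
- move=> k; apply: multiplier_sg => [|x]; last exact: sin_max.
  have [Hc Hs] := multiplier_cos_sin (k.+1%:R^-1 *: delta_mx ord0 i).
  have -> : (fun x : T => sin (((x : 'rV[R]_n) ord0 i - a) / k.+1%:R)) =
      (fun x : T => cos (a / k.+1%:R) * sin (dot (k.+1%:R^-1 *: delta_mx ord0 i) x)
        - sin (a / k.+1%:R) * cos (dot (k.+1%:R^-1 *: delta_mx ord0 i) x)).
    apply/funext => x; rewrite dotZl dot_delta mulrBl sinB.
    by rewrite [k.+1%:R^-1 * _]mulrC [cos (a / _) * _]mulrC [sin (a / _) * _]mulrC.
  by apply: multiplierB; exact: multiplierZ.
- by move=> k x; rewrite normr_sg; case: eqP.
by move=> x; exact: sg_sin_cvg.
Qed.

Definition multiplier_set (A : set T) := multiplier (\1_A : T -> R).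

Lemma multiplier_set0 : multiplier_set set0.
Proof. by rewrite /multiplier_set indic0; exact: multiplier_cst. Qed.

Lemma multiplier_setC A : multiplier_set A -> multiplier_set (~` A).
Proof.
move=> HA; rewrite /multiplier_set.
have -> : \1_(~` A) = (fun x : T => 1 - \1_A x : R).
  apply/funext => x; rewrite !indicE in_setC.
  by case: (x \in A) => /=; rewrite ?subrr ?subr0.
exact/multiplierB/HA/multiplier_cst.
Qed.

Lemma multiplier_setI (I : Type) (s : seq I) (F : I -> set T) (A : set T) :
  (forall i, multiplier_set (F i)) ->
  (forall x, \1_A x = \prod_(i <- s) \1_(F i) x :> R) -> multiplier_set A.
Proof.
move=> HF HA; rewrite /multiplier_set.
have -> : \1_A = (fun x => \prod_(i <- s) \1_(F i) x) :> (T -> R) by apply/funext.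
exact: multiplier_prod.
Qed.

Lemma multiplier_bigcup (F : nat -> set T) : (forall k, multiplier_set (F k)) ->
  multiplier_set (\bigcup_k F k).
Proof.
move=> HF.
(* The product is the indicator of the complement of a partial union; at each point it is eventually
   constant in [k]. *)
have p01 k x : \prod_(i <- iota 0 k) (1 - \1_(F i) x) =
    ([forall i : 'I_k, x \notin F i])%:R :> R.
  have -> : iota 0 k = index_iota 0 k by rewrite /index_iota subn0.
  rewrite big_mkord.
  have [/forallP H|] := boolP [forall i : 'I_k, x \notin F i].
    by rewrite big1// => i _; rewrite indicE (negbTE (H i)) subr0.
  rewrite negb_forall; case/fintype.existsP => i; rewrite negbK => xi.
  by rewrite (bigD1 i)//= indicE xi subrr mul0r.
apply: (@multiplier_lim (fun k x => 1 - \prod_(i <- iota 0 k) (1 - \1_(F i) x)) _ 1).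
- move=> k; apply: multiplierB; first exact: multiplier_cst.
  by apply: multiplier_prod => i; apply: multiplierB; [exact: multiplier_cst|exact: HF].
- by move=> k x; rewrite p01; case: [forall _, _]; rewrite ?subrr ?normr0 ?subr0 ?normr1.
move=> x; apply: cvg_near_cst; rewrite indicE.
have [[k _ Fk]|nF] := pselect ((\bigcup_k F k) x).
  rewrite mem_set; last by exists k.
  exists k.+1 => // m /= km; rewrite p01.
  have -> : [forall i : 'I_m, x \notin F i] = false; last by rewrite subr0.
  apply/negbTE; rewrite negb_forall; apply/fintype.existsP; exists (Ordinal km).
  by rewrite negbK inE.
rewrite memNset//; apply: nearW => m; rewrite p01.
have -> : [forall i : 'I_m, x \notin F i]; last by rewrite subrr.
by apply/forallP => i; rewrite notin_setE => Fi; apply: nF; exists i.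
Qed.

(** The sign [eps] chooses between the two open half-spaces bounded by [x_i = a]. The polynomial
    [(s + s^2) / 2] sends the values -1, 0, 1 of a sign to 0, 0, 1. *)
Lemma multiplier_gt (i : 'I_n) (a : R) (eps : bool) :
  multiplier_set [set x : T | 0 < (-1) ^+ eps * ((x : 'rV[R]_n) ord0 i - a)].
Proof.
have Hs := multiplier_sg_coord i a; rewrite /multiplier_set.
pose s (x : T) := (-1) ^+ eps * Num.sg ((x : 'rV[R]_n) ord0 i - a).
have -> : \1_[set x : T | 0 < (-1) ^+ eps * ((x : 'rV[R]_n) ord0 i - a)] =
    (fun x => 2^-1 * (s x + s x ^+ 2)) :> (T -> R).
  apply/funext => x; rewrite indicE /s; set d := _ - a.
  have -> : (x \in [set x : T | 0 < (-1) ^+ eps * ((x : 'rV[R]_n) ord0 i - a)]) =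
      (0 < (-1) ^+ eps * d) by apply/idP/idP; rewrite inE.
  have -> : (-1) ^+ eps * Num.sg d = Num.sg ((-1) ^+ eps * d).
    by rewrite sgrM; case: (eps); rewrite ?expr1 ?expr0 ?sgr1 ?sgrN1.
  case: sgrP => _; rewrite ?expr1n ?expr0n ?addr0 ?mulr0 ?ltxx//=.
    by field.
  by rewrite sqrrN expr1n addNr mulr0.
have Hs' : multiplier s by exact: multiplierZ.
by apply/multiplierZ/multiplierD => //; exact: multiplierX.
Qed.

Lemma multiplier_borel (A : set T) : measurable A -> multiplier_set A.
Proof.
apply: smallest_sub; first split.
- exact: multiplier_set0.
- by move=> B HB; rewrite setTD; exact: multiplier_setC.
- exact: multiplier_bigcup.
move=> U /open_rV_bigcup_boxes[q [r [b ->]]]; apply: multiplier_bigcup => k.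
case: (b k); last exact: multiplier_set0.
(* The box is the intersection of [x_i > q_i - r] (flag [false]) and [x_i < q_i + r] (flag [true])
   over all [i]. *)
pose F (ie : 'I_n * bool) := [set x : T | 0 < (-1) ^+ ie.2 *
  ((x : 'rV[R]_n) ord0 ie.1 - (q k ord0 ie.1 - (-1) ^+ ie.2 * r k))].
apply: (@multiplier_setI _ (index_enum {: 'I_n * bool}) F) => [ie|x].
  exact: multiplier_gt.
rewrite indicE; have [xb|xb] := boolP (x \in _).
  rewrite big1// => -[i e] _; rewrite indicE mem_set//=.
  move: xb; rewrite inE/= => /(_ i); rewrite ltr_norml /F/= => /andP[x1 x2].
  by case: e => /=; rewrite ?expr1 ?expr0; lra.
have [ie Fie] : exists ie, x \notin F ie.
  apply/not_existsP => H; move/negP: xb; apply; rewrite inE/= => i.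
  have /negP := H (i, false); have /negP := H (i, true); rewrite !negbK !inE /F/=.
  by rewrite expr1 expr0 ltr_norml => ? ?; apply/andP; split; lra.
by rewrite (bigD1 ie)//= indicE (negbTE Fie) mul0r.
Qed.

Lemma nonneg_Lp_closure (u : T -> R) : (forall x, 0 <= u x) ->
  cLfun mu p (fun x => (u x)%:C%C) -> K (fun x => (u x)%:C%C).
Proof.
move=> u0 Lu; have mu' : measurable_fun setT u by case: Lu.
have mu'' : measurable_fun setT (EFin \o u) by exact/measurable_EFinP.
have u0' : forall x, setT x -> (0 <= (EFin \o u) x)%E by move=> x _; rewrite lee_fin.
pose g := nnsfun_approx measurableT mu''.
have gu k x : g k x <= u x.
  by rewrite -lee_fin /g nnsfun_approxE; exact: le_approx.
have g0 k x : 0 <= g k x by [].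
have gn k x : normc (g k x)%:C%C <= normc (u x)%:C%C.
  by rewrite !normc_real !ger0_norm.
apply: (Lp_closure_dominated p_ge1 pol_Lp (F := fun k x => (g k x)%:C%C)
  (g := fun x => (u x)%:C%C)) => //.
- move=> k; have [_ _] : multiplier (g k).
    have /funext -> := fimfunEord (g k).
    by apply: multiplier_sum => i; apply/multiplierZ/multiplier_borel.
  move=> /(_ _ (polK (@polynomials_cst R n 1))).
  by under eq_fun do rewrite mulr1.
move=> x; have : `|g k x - u x| @[k --> \oo] --> `|u x - u x|.
  apply: cvg_norm; apply: cvgB; last exact: cvg_cst.
  exact: (fine_cvg (cvg_nnsfun_approx measurableT mu'' u0' (x := x) I)).
rewrite subrr normr0.
have -> // : (fun k => `|g k x - u x|) = (fun k => normc ((g k x)%:C%C - (u x)%:C%C)).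
by apply/funext => k; rewrite -rmorphB normc_real.
Qed.

Lemma polynomials_dense : dense_in_Lp mu p pol.
Proof.
split=> // f Lf e e0.
suff [_ /(_ (e / 2))] : K f.
  rewrite divr_gt0// => /(_ isT)[g Pg fg]; exists g => //.
  by apply: (le_lt_trans fg); rewrite lte_fin ltr_pdivrMr// ltr_pMr// ltr1n.
have [mRe mIm _] := Lf.
have KR (h : T -> R) : measurable_fun setT h -> (forall x, `|h x| <= normc (f x)) ->
    K (fun x => (h x)%:C%C).
  move=> mh hf.
  have part (u : T -> R) : measurable_fun setT u -> (forall x, 0 <= u x) ->
      (forall x, u x <= `|h x|) -> K (fun x => (u x)%:C%C).
    move=> mu' u0 uh; apply: nonneg_Lp_closure => //.
    apply: (cLfun_le p_ge1 _ Lf ler01) => [|x]; first exact: cmeasurable_real.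
    by rewrite normc_real ger0_norm// mul1r (le_trans (uh x)).
  have -> : (fun x => (h x)%:C%C) = (fun x =>
      ((`|h x| + h x) / 2)%:C%C + (-1) * ((`|h x| - h x) / 2)%:C%C).
    by apply/funext => x; rewrite mulN1r -rmorphB/=; congr (_%:C)%C; field.
  have mn : measurable_fun setT (fun x => `|h x|) by exact: measurableT_comp.
  apply: KD; last apply: KZ; apply: part.
  - by apply: measurable_funM => //; exact: measurable_funD.
  - by move=> x; rewrite divr_ge0//; have := ler_norm (- h x); rewrite normrN; lra.
  - by move=> x; rewrite ler_pdivrMr// mulr_natr mulr2n lerD2l ler_norm.
  - by apply: measurable_funM => //; exact: measurable_funB.
  - by move=> x; rewrite divr_ge0// subr_ge0 ler_norm.
  - move=> x; rewrite ler_pdivrMr// mulr_natr mulr2n lerD2l.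
    by rewrite -normrN ler_norm.
have -> : f = (fun x => (complex.Re (f x))%:C%C + 'i%C * (complex.Im (f x))%:C%C).
  by apply/funext => x; rewrite -complexE.
apply: KD; last apply: KZ; apply: KR => // x.
  exact: Re_le_normc.
exact: Im_le_normc.
Qed.

End Multipliers.

(** * Spans of exponentials *)

Section ComplexSpan.
Context (R : realType) (T : Type) (A : set (T -> R[i])).

Lemma cspan0 : cspan A (fun=> 0).
Proof.
exists 0%N, (fun=> 0), (fun _ _ => 0); split; first by case.
by apply/funext => x; rewrite big_ord0.
Qed.

Lemma cspanZ (c : R[i]) f : cspan A f -> cspan A (fun x => c * f x).
Proof.
move=> [k [a [g [Ag ->]]]]; exists k, (fun j => c * a j), g; split=> //.
by apply/funext => x; rewrite mulr_sumr; apply: eq_bigr => j _; rewrite mulrA.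
Qed.

Lemma cspanD f g : cspan A f -> cspan A g -> cspan A (fun x => f x + g x).
Proof.
move=> [k [a [u [Au ->]]]] [l [b [v [Av ->]]]].
exists (k + l)%N,
  (fun j => match fintype.split j with inl i => a i | inr i => b i end),
  (fun j => match fintype.split j with inl i => u i | inr i => v i end).
split; first by move=> j; case: (fintype.split j).
apply/funext => x; rewrite big_split_ord/=; congr (_ + _); apply: eq_bigr => i _.
  by rewrite (unsplitK (inl i)).
by rewrite (unsplitK (inr i)).
Qed.

Lemma sub_cspan : A `<=` cspan A.
Proof.
move=> f Af; exists 1%N, (fun=> 1), (fun=> f); split=> //.
by apply/funext => x; rewrite big_ord1 mul1r.
Qed.

End ComplexSpan.

Section Exponentials.
Context (R : realType) (n : nat) (mu : {measure set (borelRn R n) -> \bar R}).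
Context (p : R).
Hypothesis p_ge1 : 1 <= p.
Hypothesis mu_moments : finite_moments mu.
Local Notation T := (borelRn R n).
Local Notation pol := (@polynomials R n : set (T -> R[i])).
Context (S : set 'rV[R]_n).
Local Notation W := (cspan (exponentials S) : set (T -> R[i])).
Local Notation K := (Lp_closure mu p W).

Let WD f g : W f -> W g -> W (fun x => f x + g x).
Proof. exact: cspanD. Qed.
Let WZ c f : W f -> W (fun x => c * f x).
Proof. exact: cspanZ. Qed.

Let expi_Lp l : cLfun mu p (fun x : T => expi l x).
Proof.
apply: (bounded_cLfun mu_moments (C := 1)) => //; first exact: cmeasurable_expi.
by move=> x; rewrite normc_expi.
Qed.

Lemma cspan_exponentials_Lp : W `<=` cLfun mu p.
Proof.
move=> _ [k [c [g [Sg ->]]]]; elim: k c g Sg => [|k IH] c g Sg.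
  under eq_fun do rewrite big_ord0.
  by apply: finite_moments_cLfun => //; exact: polynomials_cst.
under eq_fun do rewrite big_ord_recl.
apply: cLfunD => //; first by apply: cLfunZ => //; have [l _ <-] := Sg ord0.
by apply: (IH (fun i => c (lift ord0 i)) (fun i => g (lift ord0 i))) => i.
Qed.

Let KD f g : K f -> K g -> K (fun x => f x + g x).
Proof. by move=> Kf Kg; apply: Lp_closureD => //; exact: cspan_exponentials_Lp. Qed.
Let KZ c f : K f -> K (fun x => c * f x).
Proof. by move=> Kf; apply: Lp_closureZ => //; exact: cspan_exponentials_Lp. Qed.

(** A polynomial majorant of [enorm x], which brings Lipschitz bounds in the frequency into L_p. *)
Lemma polynomials_sqnorm : pol (fun x => (1 + dot x x)%:C%C).
Proof.
under eq_fun do rewrite rmorphD/=.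
apply: polynomialsD; first exact: polynomials_cst.
rewrite /dot; elim: (index_enum _) => [|i s IH].
  by under eq_fun do rewrite big_nil; exact: polynomials_cst.
under eq_fun do rewrite big_cons rmorphD rmorphM/=.
by apply: polynomialsD => //; apply: polynomialsM; exact: polynomials_coord.
Qed.

Lemma cLnorm_expi_lipschitz : exists2 B, 0 <= B & forall (l l' : 'rV[R]_n) d,
  0 <= d -> (forall i, `|l ord0 i - l' ord0 i| <= d) ->
  (cLnorm mu p (fun x : T => expi l x - expi l' x)%R <= (d * B)%:E)%E.
Proof.
have Lg := finite_moments_cLfun mu_moments p_ge1 polynomials_sqnorm.
have [mg gy] := (cLfunP _ _ _).1 Lg.
have gE : (cLnorm mu p (fun x : T => (1 + dot x x)%:C%C))%E =
    (fine (cLnorm mu p (fun x : T => (1 + dot x x)%:C%C)))%:E.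
  by rewrite fineK// ge0_fin_numE ?cLnorm_ge0.
exists (2 * n%:R * fine (cLnorm mu p (fun x : T => (1 + dot x x)%:C%C))).
  by rewrite mulr_ge0// fine_ge0 ?cLnorm_ge0.
move=> l l' d d0 ld; rewrite mulrA EFinM -gE.
apply: cLnorm_leM => //.
- by apply: cmeasurableB; exact: cmeasurable_expi.
- by rewrite !mulr_ge0.
move=> x; rewrite !expiE normc_real ger0_norm ?addr_ge0 ?dot_ge0//.
apply: (le_trans (cis_lipschitz _ _)); rewrite -dotBl.
apply: (@le_trans _ _ (2 * (n%:R * d * enorm x))).
  rewrite ler_wpM2l//; apply: (le_trans (dot_le_enorm _ _)).
  rewrite ler_wpM2r ?enorm_ge0//.
  apply: (@le_trans _ _ (\sum_(i < n) d)); last by rewrite sumr_const card_ord mulr_natl.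
  by apply: ler_sum => i _; rewrite !mxE.
have -> : d * (2 * n%:R) * (1 + dot x x) = 2 * (n%:R * d * (1 + dot x x)) by ring.
rewrite ler_wpM2l// ler_wpM2l ?mulr_ge0//.
have := sqr_sqrtr (dot_ge0 x); rewrite -/(enorm x) => <-.
by have := sqr_ge0 (enorm x - 1); rewrite sqrrB1; have := enorm_ge0 x; nra.
Qed.

Lemma expi_closure l : closure S l -> K (fun x => expi l x).
Proof.
move=> Sl; split=> // e e0; have [B B0 HB] := cLnorm_expi_lipschitz.
have B1 : 0 < B + 1 by rewrite ltr_wpDl.
have d0 : 0 < e / (B + 1) by rewrite divr_gt0.
have [l' [Sl' [_ ll']]] := Sl _ (nbhsx_ballx l _ d0).
exists (expi l'); first by apply: sub_cspan; exists l'.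
apply: le_trans (HB _ _ _ (ltW d0) _) _; first by move=> i; exact/ltW/ll'.
by rewrite lee_fin mulrAC ler_pdivrMr// ler_wpM2l ?(ltW e0)// lerDl.
Qed.

(** Multiplication by [x_i] is, up to the factor [i], differentiation in the frequency [l]. Interior
    points are needed so that [l] can be moved by a small [h] along each axis. *)
Lemma polynomials_expi_closure P : pol P ->
  forall l, (closure S)° l -> K (fun x => P x * expi l x).
Proof.
(* The induction also carries [pol P], because the second-order remainder is controlled by the norm
   of [x_i^2 P]. *)
have key : forall P, pol P -> pol P /\ forall l, (closure S)° l ->
    K (fun x => P x * expi l x).
  move=> {}P PP; pattern P; apply: mpoly_fun_ind PP => [c|f g [Pf Kf] [Pg Kg]|i f [Pf Kf]].
  - split; first exact: polynomials_cst.
    by move=> l Sl; apply: KZ; apply: expi_closure; exact: interior_subset.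
  - split; first exact: polynomialsD.
    by move=> l Sl; under eq_fun do rewrite mulrDl; apply: KD; [exact: Kf|exact: Kg].
  have Pxf := polynomialsM (polynomials_coord R i) Pf.
  have Pxxf := polynomialsM (polynomials_coord R i) Pxf.
  split=> // l Sl; apply: Lp_closed => //.
    exact: cspan_exponentials_Lp.
    exact: polynomials_expi_cLfun.
  move=> e e0; have Lg := finite_moments_cLfun mu_moments p_ge1 Pxxf.
  have [mg gy] := (cLfunP _ _ _).1 Lg.
  set g := (fun x => _) in mg gy Lg Pxxf.
  have gE : (cLnorm mu p g) = (fine (cLnorm mu p g))%:E.
    by rewrite fineK// ge0_fin_numE ?cLnorm_ge0.
  set B := fine _ in gE; have B0 : 0 <= B by rewrite fine_ge0 ?cLnorm_ge0.
  have /nbhs_ballP[r /= r0 rS] : nbhs l (closure S)°.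
    by apply: open_nbhs_nbhs; split=> //; exact: open_interior.
  have B1 : 0 < 2 * B + 1 by rewrite ltr_wpDl// mulr_ge0.
  (* The first bound keeps the shifted frequency in the ball, the second makes the error [2 h B] at
     most [e]. *)
  pose h := Num.min (r / 2) (e / (2 * B + 1)).
  have h0 : 0 < h by rewrite lt_min !divr_gt0.
  have hr : h < r.
    by rewrite gt_min; apply/orP; left; rewrite ltr_pdivrMr// ltr_pMr// ltr1n.
  have he : 2 * h * B <= e.
    have : h * (2 * B + 1) <= e by rewrite -ler_pdivlMr// ge_min lexx orbT.
    by apply: le_trans; rewrite mulrDr mulr1 mulrCA mulrA lerDl ltW.
  have Slh : (closure S)° (l + h *: delta_mx ord0 i).
    apply: rS; split=> // a b; rewrite (ord1 a) /ball/= !mxE eqxx/=.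
    rewrite opprD addNKr normrN; case: (b == i); rewrite ?mulr1 ?mulr0 ?normr0//.
    by rewrite gtr0_norm.
  (* [c = 1 / (i h)], so that [c (cis s - 1)] with [s = h x_i] approximates [x_i]. *)
  pose c : R[i] := (0 -i* h^-1)%C.
  exists (fun x => c * (f x * expi (l + h *: delta_mx ord0 i) x) +
      (- c) * (f x * expi l x)).
    by apply: KD; apply: KZ; apply: Kf.
  apply: (@le_trans _ _ ((2 * h)%:E * cLnorm mu p g)%E); last first.
    by rewrite gE -EFinM lee_fin.
  have mf := cmeasurable_polynomials Pf.
  have me k : cmeasurable (fun x : T => f x * expi k x).
    by apply: cmeasurableM => //; exact: cmeasurable_expi.
  apply: cLnorm_leM => //.
  - apply: cmeasurableB.
      by apply: cmeasurableM; [exact: cmeasurable_polynomials|exact: cmeasurable_expi].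
    by apply: cmeasurableD; apply: cmeasurableZ.
  - by rewrite mulr_ge0// ltW.
  move=> x; pose s : R := h * x ord0 i.
  have -> : (x ord0 i)%:C%C * f x * expi l x -
      (c * (f x * expi (l + h *: delta_mx ord0 i) x) + - c * (f x * expi l x)) =
      (- c) * (f x * expi l x) *
      (cis s - \sum_(k < 2) 'i%C ^+ k * (s ^+ k / k`!%:R)%:C%C).
    rewrite expiD [expi (h *: _) x]expiE dotZl dot_delta -/s.
    rewrite !big_ord_recl big_ord0 expr0 fact0 divr1 expr0 expr1 mul1r addr0.
    rewrite /bump/= ?addn0 ?expr1 ?fact1 ?divr1.
    have -> : (x ord0 i)%:C%C = c * ('i%C * s%:C%C).
      rewrite /s /c; apply/eqP; rewrite eq_complex /=.
      by apply/andP; split; apply/eqP; field; rewrite gt_eqF.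
    by rewrite rmorph1; ring.
  rewrite !ComplexField.Normc.normcM normc_expi mulr1 normcN.
  have -> : normc c = h^-1.
    by rewrite /c /= expr0n add0r sqrrN sqrtr_sqr ger0_norm// invr_ge0 ltW.
  rewrite !normc_real.
  apply: le_trans (ler_wpM2l _ (taylor_cis 2 s)) _.
    by rewrite mulr_ge0 ?normc_ge0// invr_ge0 ltW.
  rewrite /s normrM exprMn (gtr0_norm h0) le_eqVlt; apply/orP; left; apply/eqP.
  by field; rewrite gt_eqF.
by move=> PP; have [] := key P PP.
Qed.

Lemma exponentials_dense : somewhere_dense S -> dense_in_Lp mu p pol ->
  dense_in_Lp mu p W.
Proof.
move=> [l Sl] [_ pol_dense]; split; first exact: cspan_exponentials_Lp.
move=> f Lf e e0; have e2 : 0 < e / 2 by rewrite divr_gt0.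
have [mf fy] := (cLfunP _ _ _).1 Lf.
have mfl : cmeasurable (fun x : T => f x * expi (- l) x).
  by apply: cmeasurableM => //; exact: cmeasurable_expi.
have Lfl : cLfun mu p (fun x => f x * expi (- l) x).
  apply: (cLfun_le p_ge1 mfl Lf ler01) => x.
  by rewrite ComplexField.Normc.normcM normc_expi mulr1 mul1r.
have [P PP fP] := pol_dense _ Lfl _ e2.
have mP := cmeasurable_polynomials PP.
have [_ /(_ _ e2)[g Wg Pg]] := polynomials_expi_closure PP Sl.
exists g => //.
have mg : cmeasurable g by have [] := (cLfunP _ _ _).1 (cspan_exponentials_Lp Wg).
have mPl : cmeasurable (fun x : T => P x * expi l x).
  by apply: cmeasurableM => //; exact: cmeasurable_expi.
have -> : (fun x => f x - g x) =
    (fun x => (f x - P x * expi l x) + (P x * expi l x - g x)).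
  by apply/funext => x; rewrite subrKA.
apply: le_lt_trans (cLnormD mu p_ge1 _ _) _; try exact: cmeasurableB.
rewrite [e]splitr EFinD; apply: lte_leD => //.
  by rewrite ge0_fin_numE ?cLnorm_ge0// (le_lt_trans Pg) ?ltry.
apply: le_lt_trans fP; apply: cLnorm_le => //; try exact: cmeasurableB.
move=> x; have -> : f x - P x * expi l x = (f x * expi (- l) x - P x) * expi l x.
  by rewrite mulrBl -mulrA -expiD addNr expi0 mulr1.
by rewrite ComplexField.Normc.normcM normc_expi mulr1.
Qed.

End Exponentials.

(** * Moments of a quasi-analytic measure and determinacy *)

Section QuasiAnalyticMeasure.
Context (R : realType) (n : nat) (w : 'rV[R]_n -> R) (C : R).
Context (v : n.-tuple 'rV[R]_n).
Hypothesis C_ge1 : 1 <= C.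
Hypothesis w_ge0 : forall x, 0 <= w x.
Hypothesis w_leC : forall x, w x <= C.
Hypothesis v_basis : basis_of fullv v.
Hypothesis w_qa : quasi_analytic_wrt v w.

Let y (j : 'I_n) (x : 'rV[R]_n) := dot (tnth v j) x.
Let U j := weight_seq (y j) (fun x => w x / C).

Let C_gt0 : 0 < C. Proof. exact: lt_le_trans C_ge1. Qed.

Let z_ge0 x : 0 <= w x / C. Proof. by rewrite divr_ge0// ltW. Qed.
Let z_le1 x : w x / C <= 1. Proof. by rewrite ler_pdivrMr// mul1r. Qed.

Let yz_bounded j (m : nat) : exists B, forall x, `|y j x| ^+ m * (w x / C) <= B.
Proof. exact: (normalized_weight_bounded 0 C_ge1 w_ge0 w_leC (w_qa j)). Qed.

(** The assumption is a bound on even moments and not the integrability of [1 / w], since only the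
    former is available for [mu + nu]. *)
Lemma quasi_analytic_dense (mu : {measure set (borelRn R n) -> \bar R}) (D : R) :
  finite_moments mu -> 0 <= D ->
  (forall j (m : nat), (\int[mu]_x (y j (x : 'rV[R]_n) ^+ (2 * m))%:E <=
    (D * U j (2 * m)%N)%:E)%E) ->
  forall p, 1 <= p -> dense_in_Lp mu p (@polynomials R n).
Proof.
move=> mu_moments D0 HD p p1.
apply: polynomials_dense => //; apply: (expi_stable_all p1 mu_moments v_basis) => j.
pose r := Num.bound p.
have pr : p <= r%:R by exact/ltW/archi_boundP/(le_trans ler01).
have r0 : (0 < r)%N by rewrite -(ltr0n R) (lt_le_trans _ pr)// (lt_le_trans ltr01).
have Q0 : (0 < 2 * r)%N by rewrite muln_gt0.
have U1 m : 1 <= U j m by exact: (weight_seq_ge1 0 (yz_bounded j)).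
have U0 m : 0 < U j m by exact: lt_le_trans (U1 m).
have rootX (a : R) (k : nat) : 0 < a -> (0 < k)%N -> (a `^ (k%:R^-1)) ^+ k = a.
  move=> a0 k0; rewrite -powR_mulrn ?powR_ge0// -powRrM mulVf ?pnatr_eq0 -?lt0n//.
  by rewrite powRr1// ltW.
have root_seqs : exists M ro : nat -> R, [/\ forall k, 0 < M k,
    forall k, M k ^+ (2 * r) = U j (2 * r * k)%N, forall m, 1 <= ro m,
    forall m, ro m ^+ m = U j m &
    forall B, exists N : nat, B <= \sum_(m < N) (ro m.+1)^-1].
  exists (fun k => U j (2 * r * k)%N `^ ((2 * r)%:R^-1)), (fun m => U j m `^ (m%:R^-1)).
  split.
  - by move=> k; rewrite powR_gt0.
  - by move=> k; rewrite rootX.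
  - move=> m; apply: (@le_trans _ _ (1 `^ (m%:R^-1))); first by rewrite powR1.
    by rewrite ge0_ler_powR ?nnegrE ?invr_ge0 ?ler01 ?U1// ltW.
  - case=> [|m]; last by rewrite rootX.
    by rewrite expr0 /U (weight_seq0 0 z_ge0 z_le1 (yz_bounded j)).
  - exact: (qa_weight_seq_div 0 C_ge1 w_ge0 w_leC (w_qa j)).
have [M [ro [M0 MX ro1 roX ro_div]]] := root_seqs.
apply: (@expi_directionP _ _ mu p p1 mu_moments _ M M0).
- apply: (root_seq_logconvex Q0 _ M0 MX) => m s.
  exact: (weight_seq_logconvex 0 z_ge0 (yz_bounded j)).
- apply: (root_seq_div Q0 _ _ ro1 roX M0 MX) => //.
    exact: (weight_seq0 0 z_ge0 z_le1 (yz_bounded j)).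
  by move=> a b; exact: (weight_seq_roots 0 z_ge0 z_le1 (yz_bounded j)).
apply: (polynomial_power_bound p1 mu_moments pr M0 D0) => k.
by rewrite MX -mulnA; exact: HD.
Qed.

Lemma even_moment_weight j (m : nat) (x : 'rV[R]_n) :
  y j x ^+ (2 * m) * w x <= C * U j (2 * m)%N.
Proof.
have := weight_seq_ge 0 (yz_bounded j) (2 * m) x.
have -> : `|y j x| ^+ (2 * m) = y j x ^+ (2 * m).
  by rewrite -normrX ger0_norm// exprM exprn_ge0// sqr_ge0.
by rewrite mulrA ler_pdivrMr// [U j _ * _]mulrC => H; apply: H.
Qed.

(** Expanding coordinates in the basis bounds [enorm] by a multiple of the sum of the [|y j|], each
    with bounded powers against [w]. Inside the unit ball [w <= C] suffices; outside, the real
    exponent [d] is raised to an integer [k]. *)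
Lemma enorm_weight_bounded (d : R) : 0 <= d ->
  exists B, forall x, enorm x `^ d * w x <= B.
Proof.
move=> d0.
have [A [A0 HA]] : exists A, 0 <= A /\
    forall x, enorm x <= A * \sum_(j < n) `|y j x|.
  exists (\sum_(i < n) \sum_(j < n) `|coord v j (delta_mx ord0 i)|).
  split; first by rewrite sumr_ge0// => i _; rewrite sumr_ge0.
  move=> x; apply: (le_trans (enorm_le_sum x)); rewrite mulr_suml.
  apply: ler_sum => i _; rewrite -dot_delta [delta_mx ord0 i](coord_basis v_basis (memvf _)).
  rewrite dot_suml; apply: le_trans (ler_norm_sum _ _ _) _.
  rewrite mulr_suml; apply: ler_sum => j _.
  rewrite dotZl normrM -(coord_basis v_basis (memvf _)) ler_wpM2l//.
  rewrite -tnth_nth (bigD1 j)//= lerDl sumr_ge0//.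
pose k := (2 * Num.bound d)%N.
have dk : d <= k%:R.
  apply: (le_trans (ltW (archi_boundP d0))); rewrite ler_nat /k mul2n -addnn.
  exact: leq_addr.
have sum_pow (m : nat) (F : 'I_m -> 'rV[R]_n -> R) : (forall i x, 0 <= F i x) ->
    (forall i, exists B, forall x, F i x ^+ k * w x <= B) ->
    exists B, forall x, (\sum_(i < m) F i x) ^+ k * w x <= B.
  elim: m F => [|m IH] F F0 HF.
    exists (0 ^+ k * C) => x; rewrite big_ord0 ler_wpM2l// exprn_ge0//.
  have [B HB] := IH (fun i => F (lift ord0 i)) (fun i => F0 _) (fun i => HF _).
  have [B' HB'] := HF ord0; exists (2 ^+ k * (B' + B)) => x.
  rewrite big_ord_recl; set a := F ord0 x; set b := \sum_(i < m) _.
  have a0 : 0 <= a by exact: F0.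
  have b0 : 0 <= b by apply: sumr_ge0 => i _; exact: F0.
  apply: (@le_trans _ _ (2 ^+ k * (a ^+ k * w x + b ^+ k * w x))); last first.
    by rewrite ler_wpM2l ?exprn_ge0// lerD ?HB ?HB'.
  rewrite -mulrDl mulrA ler_wpM2r//.
  have [ab|ba] := leP a b.
    apply: (@le_trans _ _ ((2 * b) ^+ k)).
      by rewrite lerXn2r ?nnegrE ?addr_ge0 ?mulr_ge0// mulr_natl mulr2n lerD2r.
    by rewrite exprMn ler_wpM2l ?exprn_ge0// lerDr exprn_ge0.
  apply: (@le_trans _ _ ((2 * a) ^+ k)).
    by rewrite lerXn2r ?nnegrE ?addr_ge0 ?mulr_ge0// mulr_natl mulr2n lerD2l ltW.
  by rewrite exprMn ler_wpM2l ?exprn_ge0// lerDl exprn_ge0.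
have [B HB] := @sum_pow n (fun j x => `|y j x|) (fun _ _ => normr_ge0 _)
  (fun j => qa_weight_bounded 0 C_ge1 w_ge0 w_leC (w_qa j) k).
exists (C + A ^+ k * B) => x.
have e0 := enorm_ge0 x; have [x1|x1] := leP (enorm x) 1.
  have B0 : 0 <= A ^+ k * B.
    rewrite mulr_ge0 ?exprn_ge0//; apply: le_trans (HB 0).
    by rewrite mulr_ge0 ?exprn_ge0 ?sumr_ge0.
  rewrite -[leLHS]addr0 lerD//; apply: le_trans (w_leC x); rewrite ler_piMl//.
  apply: (@le_trans _ _ (1 `^ d)); last by rewrite powR1.
  by rewrite ge0_ler_powR ?nnegrE.
rewrite -[leLHS]add0r lerD ?(ltW C_gt0)//.
apply: (@le_trans _ _ (enorm x ^+ k * w x)).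
  by rewrite ler_wpM2r// -powR_mulrn// ler_powR// ltW.
apply: (@le_trans _ _ ((A * \sum_(j < n) `|y j x|) ^+ k * w x)).
  by rewrite ler_wpM2r// lerXn2r ?nnegrE ?mulr_ge0 ?sumr_ge0.
by rewrite exprMn -mulrA ler_wpM2l ?exprn_ge0.
Qed.

Section Integral.
Context (mu : {measure set (borelRn R n) -> \bar R}).
Hypothesis w_meas : measurable_fun setT (w : borelRn R n -> R).
Hypothesis w_int : (\int[mu]_x ((w (x : 'rV[R]_n))%:E)^-1 < +oo)%E.

Let I := (\int[mu]_x ((w (x : 'rV[R]_n))%:E)^-1)%E.

Let measurable_winv : measurable_fun setT (fun x : borelRn R n => ((w x)%:E)^-1)%E.
Proof.
have -> : (fun x : borelRn R n => ((w x)%:E)^-1)%E =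
    (fun x : borelRn R n => if w x == 0%R then +oo else (w x `^ (-1))%:E)%E.
  by apply/funext => x; rewrite inver powR_inv1.
apply: measurable_fun_ifT => //.
  by apply: measurable_fun_eqr => //; exact: measurable_cst.
by apply/measurable_EFinP; exact: measurable_fun_powR.
Qed.

Lemma integral_le_weight (f : borelRn R n -> R) (B : R) :
  measurable_fun setT f -> (forall x, 0 <= f x) -> 0 < B ->
  (forall x, f x * w x <= B) ->
  (\int[mu]_x (f x)%:E <= (B * fine I)%:E)%E.
Proof.
move=> mf f0 B0 fB.
have I0 : (0 <= I)%E by apply: integral_ge0 => x _; rewrite inve_ge0 lee_fin.
have winv0 (x : 'rV[R]_n) : (0 <= ((w x)%:E)^-1)%E by rewrite inve_ge0 lee_fin.
rewrite EFinM fineK ?ge0_fin_numE// /I -ge0_integralZl//; last first.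
  by rewrite lee_fin ltW.
apply: ge0_le_integral => //.
- by move=> x _; rewrite lee_fin.
- exact/measurable_EFinP.
- exact: emeasurable_funM.
(* Pointwise [f <= B / w]. Where [w] vanishes the right-hand side is [B * +oo], which is [+oo]
   because [B > 0]. *)
move=> x _; rewrite inver; case: eqVneq => [wx|wx].
  by rewrite mulry gtr0_sg// mul1e leey.
by rewrite -EFinM lee_fin ler_pdivlMr ?fB// lt_neqAle eq_sym wx w_ge0.
Qed.

Lemma weight_finite_moments : finite_moments mu.
Proof.
move=> d d0; have [B HB] := enorm_weight_bounded d0.
apply: le_lt_trans (@integral_le_weight _ (`|B| + 1) _ _ _ _) _.
- by apply: measurable_fun_powR; exact: measurable_enorm.
- by move=> x; exact: powR_ge0.
- by rewrite ltr_wpDl.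
- move=> x; apply: (le_trans (HB x)); apply: (le_trans (ler_norm _)).
  by rewrite lerDl.
by rewrite ltry.
Qed.

Lemma weight_even_moment j (m : nat) :
  (\int[mu]_x (y j (x : 'rV[R]_n) ^+ (2 * m))%:E <=
    (C * fine I * U j (2 * m)%N)%:E)%E.
Proof.
rewrite mulrAC; apply: integral_le_weight.
- by apply: measurable_funX; exact: measurable_dot.
- by move=> x; rewrite exprM exprn_ge0// sqr_ge0.
- rewrite mulr_gt0//; apply: (lt_le_trans ltr01).
  exact: (weight_seq_ge1 0 (yz_bounded j)).
by move=> x; exact: even_moment_weight.
Qed.

End Integral.

End QuasiAnalyticMeasure.

(** * Comparison of two solutions of the moment problem *)

Section Determinacy.
Context (R : realType) (n : nat).
Local Notation T := (borelRn R n).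
Implicit Types (mu nu : {measure set T -> \bar R}).

Lemma finite_moments_add mu nu : finite_moments mu -> finite_moments nu ->
  finite_moments (measure_add mu nu).
Proof.
move=> Hmu Hnu d d0; rewrite ge0_integral_measure_add//.
- by rewrite lte_add_pinfty// ?Hmu ?Hnu.
- by move=> x _; rewrite lee_fin powR_ge0.
by apply/measurable_EFinP; apply: measurable_fun_powR; exact: measurable_enorm.
Qed.

Lemma cLfun1_Re_integrable mu (f : T -> R[i]) : cLfun mu 1 f ->
  mu.-integrable setT (EFin \o (fun x => complex.Re (f x))).
Proof.
move=> /(cLfunP _ _ _)[mf]; rewrite cLnorm_lty// => fy.
have mn := cmeasurable_normc mf; case: (mf) => mRe _.
apply/integrableP; split; first exact/measurable_EFinP.
apply: le_lt_trans fy; apply: ge0_le_integral => //.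
- by apply: measurableT_comp => //; exact/measurable_EFinP.
- by apply/measurable_EFinP; exact: measurable_fun_powR.
by move=> x _; rewrite powRr1 ?normc_ge0// lee_fin; exact: Re_le_normc.
Qed.

Lemma Rintegral_Re_close mu (f g : T -> R[i]) (e : R) :
  cLfun mu 1 f -> cLfun mu 1 g ->
  (\int[mu]_x (normc (f x - g x))%:E <= e%:E)%E ->
  `|\int[mu]_x complex.Re (f x) - \int[mu]_x complex.Re (g x)| <= e.
Proof.
move=> Lf Lg fge.
have If := cLfun1_Re_integrable Lf; have Ig := cLfun1_Re_integrable Lg.
have Lfg : cLfun mu 1 (fun x => f x - g x) by exact: cLfunB.
have Ifg := cLfun1_Re_integrable Lfg.
rewrite -RintegralB//.
have ReB (x : T) : complex.Re (f x) - complex.Re (g x) = complex.Re (f x - g x).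
  by case: (f x) (g x) => a b [].
under eq_Rintegral do rewrite ReB.
rewrite -lee_fin EFin_normr_Rintegral//; apply: le_trans fge.
have [mfg _] := (cLfunP _ _ _).1 Lfg; have mn := cmeasurable_normc mfg.
case: (mfg) => mRe _.
apply: (le_trans (le_abse_integral _ _ _)) => //; first exact/measurable_EFinP.
apply: ge0_le_integral => //.
- by apply: measurableT_comp => //; exact/measurable_EFinP.
- exact/measurable_EFinP.
by move=> x _; rewrite lee_fin; exact: Re_le_normc.
Qed.

Lemma determinate_of_dense mu : finite_moments mu ->
  (forall nu, finite_moments nu ->
    (forall P : mpoly.mpoly n R[i],
       cintegral nu (mpoly_fun P) = cintegral mu (mpoly_fun P)) ->
    dense_in_Lp (measure_add mu nu) 1 (@polynomials R n)) ->
  determinate mu.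
Proof.
move=> Hmu dense; split=> // nu Hnu same A mA.
have [_ dense1] := dense nu Hnu same.
have Hrho := finite_moments_add Hmu Hnu.
pose f (x : T) : R[i] := (\1_A x)%:C%C.
have mf : cmeasurable f by apply: cmeasurable_real; exact: measurable_indic.
have Lf (m : {measure set T -> \bar R}) : finite_moments m -> cLfun m 1 f.
  move=> Hm; apply: (bounded_cLfun Hm (C := 1)) => // x.
  by rewrite normc_real indicE; case: (x \in A); rewrite ?normr1 ?normr0.
have fA (m : {measure set T -> \bar R}) : finite_moments m ->
    m A = (\int[m]_x complex.Re (f x))%:E.
  move=> Hm; rewrite /Rintegral fineK /f/=.
    by rewrite integral_indic// setIT.
  rewrite integral_indic// setIT ge0_fin_numE//.
  by apply: le_lt_trans (finite_moments_total Hm); apply: le_measure; rewrite ?inE.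
rewrite (fA _ Hnu) (fA _ Hmu); congr EFin.
apply/eqP; rewrite -subr_eq0 -normr_le0; apply/ler_addgt0Pl => e e0; rewrite addr0.
have e2 : 0 < e / 2 by rewrite divr_gt0.
have [g Pg] := dense1 f (Lf _ Hrho) _ e2.
have mg := cmeasurable_polynomials Pg.
have mfg := cmeasurable_normc (cmeasurableB mf mg).
have -> : cLnorm (measure_add mu nu) 1 (fun x => f x - g x) =
    (\int[measure_add mu nu]_x (normc (f x - g x))%:E)%E.
  by rewrite /cLnorm Lnorm1; apply: eq_integral => x _; rewrite gee0_abs// lee_fin normc_ge0.
rewrite ge0_integral_measure_add//; last 2 first.
- by move=> x _; rewrite lee_fin normc_ge0.
- exact/measurable_EFinP.
have i0 (m : {measure set T -> \bar R}) : (0 <= \int[m]_x (normc (f x - g x))%:E)%E.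
  by apply: integral_ge0 => x _; rewrite lee_fin normc_ge0.
move=> /ltW fg.
(* Each of the two measures is dominated by their sum, so a single polynomial [g] approximates the
   indicator for both. *)
have fgmu : (\int[mu]_x (normc (f x - g x))%:E <= (e / 2)%:E)%E.
  by apply: le_trans fg; rewrite leeDl.
have fgnu : (\int[nu]_x (normc (f x - g x))%:E <= (e / 2)%:E)%E.
  by apply: le_trans fg; rewrite leeDr.
have Cmu := Rintegral_Re_close (Lf _ Hmu)
  (finite_moments_cLfun Hmu (lexx 1) Pg) fgmu.
have Cnu := Rintegral_Re_close (Lf _ Hnu)
  (finite_moments_cLfun Hnu (lexx 1) Pg) fgnu.
have gE : \int[nu]_x complex.Re (g x) = \int[mu]_x complex.Re (g x).
  by have [P _ <-] := Pg; have /eqP := same P; rewrite eq_complex => /andP[/eqP].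
rewrite gE in Cnu.
set a := (X in `|X - _|); set b := (X in `|_ - X|).
set c := \int[mu]_x complex.Re (g x) in Cmu Cnu.
have -> : a - b = (a - c) - (b - c) by ring.
by apply: le_trans (ler_normB _ _) _; rewrite [leRHS]splitr lerD.
Qed.

(** [cintegral] compares only the fine parts of integrals; finiteness of both moments lifts the
    equality to the extended reals. *)
Lemma even_moment_eq mu nu (v : 'rV[R]_n) (k : nat) :
  finite_moments mu -> finite_moments nu ->
  (forall P : mpoly.mpoly n R[i],
     cintegral nu (mpoly_fun P) = cintegral mu (mpoly_fun P)) ->
  (\int[nu]_x (dot v (x : 'rV[R]_n) ^+ (2 * k))%:E =
   \int[mu]_x (dot v (x : 'rV[R]_n) ^+ (2 * k))%:E)%E.
Proof.
move=> Hmu Hnu same.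
have PP : @polynomials R n (fun x => (dot v x ^+ (2 * k))%:C%C).
  by under eq_fun do rewrite rmorphXn/=; exact/polynomialsX/polynomials_dot.
have even0 (x : 'rV[R]_n) : 0 <= dot v x ^+ (2 * k).
  by rewrite exprM exprn_ge0// sqr_ge0.
have fin (m : {measure set T -> \bar R}) : finite_moments m ->
    (\int[m]_x (dot v (x : 'rV[R]_n) ^+ (2 * k))%:E)%E \is a fin_num.
  move=> Hm; have := cLfun1_Re_integrable (finite_moments_cLfun Hm (lexx 1) PP).
  by move/integrable_fin_num; apply.
rewrite -[LHS]fineK ?fin// -[RHS]fineK ?fin//; congr EFin.
have [P _ PE] := PP; have /eqP := same P.
by rewrite PE eq_complex => /andP[/eqP].
Qed.

End Determinacy.

Theorem theorem4p1 (R : realType) (n : nat)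
    (mu : {measure set (borelRn R n) -> \bar R})
    (w : 'rV[R]_n -> R)
    (w_weight : is_weight w)
    (w_meas : measurable_fun setT (w : borelRn R n -> R))
    (w_qa : quasi_analytic w)
    (w_int : (\int[mu]_x ((w (x : 'rV[R]_n))%:E)^-1 < +oo)%E) :
  determinate mu /\
  (forall p : R, 1 <= p ->
     dense_in_Lp mu p (@polynomials R n) /\
     (forall S : set 'rV[R]_n, somewhere_dense S ->
        dense_in_Lp mu p (cspan (exponentials S)))).
Proof.
have [w_ge0 [M [_ wM]]] := w_weight.
have [v [v_basis qa]] := w_qa.
(* [bounded_fun] gives the bound for constants strictly above [M]; this choice is one of them and is
   also at least 1. *)
pose C := `|M| + 1.
have C_ge1 : 1 <= C by rewrite lerDr.
have w_leC x : w x <= C.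
  apply: le_trans (ler_norm _) (wM C _ x I).
  by apply: (le_lt_trans (ler_norm M)); rewrite ltrDl.
have mu_moments := weight_finite_moments C_ge1 w_ge0 w_leC v_basis qa w_meas w_int.
have even := weight_even_moment C_ge1 w_ge0 w_leC qa w_meas w_int.
set D := C * _ in even.
have D0 : 0 <= D.
  apply: mulr_ge0; first exact: le_trans C_ge1.
  by apply/fine_ge0/integral_ge0 => x _; rewrite inve_ge0 lee_fin.
have dense := quasi_analytic_dense C_ge1 w_ge0 w_leC v_basis qa.
have mu_dense := dense mu D mu_moments D0 even.
split; last first.
  move=> p p1; split; first exact: mu_dense.
  by move=> S Sd; apply: exponentials_dense => //; exact: mu_dense.
apply: determinate_of_dense => // nu nu_moments same.
(* The even moments of [nu] equal those of [mu], so each of the two measures contributes one [D]. *)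
apply: (dense _ (D + D)) => //; first exact: finite_moments_add.
  by rewrite addr_ge0.
move=> j m; rewrite ge0_integral_measure_add//.
- rewrite (even_moment_eq _ _ mu_moments nu_moments same) mulrDl EFinD.
  by rewrite leeD.
- by move=> x _; rewrite lee_fin exprM exprn_ge0// sqr_ge0.
by apply/measurable_EFinP; apply: measurable_funX; exact: measurable_dot.
Qed.
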